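(* Let $\varepsilon\in(0,1)$ and $c>9/\varepsilon^2$ be constants, and let $p=p(n)\geq c\ln(n)/n$. Let $G=(V,E)$ be a random graph drawn from the Erdős–Rényi model $G(n,p)$ and consider the corresponding random shortest path metric on $G$. Let $\mathsf{TSP}$ be the length of a shortest TSP tour, $\mathsf{NN}$ the length of the tour computed by the nearest-neighbor heuristic, and $\mathsf{IN}_R$ the length of the tour computed by the insertion heuristic with an arbitrary rule $R$. Then, as $n\to\infty$, \[\mathbb{E}\left[\frac{\mathsf{NN}}{\mathsf{TSP}}\right]=O(1)\qquad\text{and}\qquad\mathbb{E}\left[\frac{\mathsf{IN}_R}{\mathsf{TSP}}\right]=O(1),\] where expectations are over both the random graph and the random edge weights.
   Context: Erdős–Rényi model $G(n,p)$: vertex set $\{1,\dots,n\}$, each pair of vertices joined by an edge independently with probability $p$. Random shortest path metric on a graph $G=(V,E)$: each edge $e$ independently receives a weight $w(e)\sim\mathrm{Exp}(1)$, and $d(u,v)$ is the minimum total weight of a $u$–$v$ path in $G$ ($\infty$ if none). The TSP instance is the complete graph on $V$ with distances $d$; a tour's length is the sum of $d$ over its consecutive pairs. Nearest-neighbor heuristic: start at some vertex $v_0$; repeatedly move from the current vertex to a nearest (w.r.t. $d$) unvisited vertex; after all vertices are visited return to $v_0$. Insertion heuristic with rule $R$: start with an optimal tour on a few initial vertices chosen according to a predefined rule $R$; then repeatedly choose a vertex according to $R$ and insert it into the current tour at the position that increases the tour length the least. The bound holds for every rule $R$. *)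

(* Defs.v *)
From HB Require Import structures.
From mathcomp Require Import all_boot all_order all_algebra.
From mathcomp Require Import all_classical all_reals all_analysis.
Set Implicit Arguments.
Unset Strict Implicit.
Unset Printing Implicit Defensive.
Import Order.TTheory GRing.Theory Num.Theory.
Import numFieldNormedType.Exports.
Local Open Scope classical_set_scope.
Local Open Scope ring_scope.

Section Metric.
Context {R : realType} {V : finType}.

(* A graph on V is given by its edge set E; an edge joining u and v is the
   two-element set [set u; v]. *)
Definition adjacent (E : {set {set V}}) : rel V := fun u v => [set u; v]%SET \in E.

Definition path_weight (w : {set V} -> R) (u : V) (p : seq V) : R :=
  \sum_(e <- pairmap (fun x y => [set x; y]%SET) u p) w e.

(* The infimum ranges over the finitely many simple u-v paths u :: p;
   it is +oo when there is none. *)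
Definition sp_dist (E : {set {set V}}) (w : {set V} -> R) (u v : V) : \bar R :=
  ereal_inf [set (path_weight w u p)%:E | p in
    [set p : seq V | [/\ path (adjacent E) u p, last u p = v & uniq (u :: p)]]].

Implicit Types (d : V -> V -> \bar R) (S : {set V}) (s : seq V).

Definition tour_on S s : Prop := uniq s /\ s =i S.

(* [next s x] is the cyclic successor of x in s, so that the edge from the last
   vertex back to the first one is counted. *)
Definition tour_length d s : \bar R := (\sum_(x <- s) d x (next s x))%E.

Definition optimal_tour_on d S s : Prop :=
  tour_on S s /\
  forall s', tour_on S s' -> (tour_length d s <= tour_length d s')%E.

Definition TSP d : \bar R :=
  ereal_inf [set tour_length d s | s in [set s | tour_on [set: V]%SET s]].

(* The sequences of visited vertices that the nearest-neighbor heuristic can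
   produce, for any starting vertex and any way of breaking ties. *)
Inductive nn_run d : seq V -> Prop :=
| nn_start v0 : nn_run d [:: v0]
| nn_step s x y :
    nn_run d (rcons s x) -> y \notin rcons s x ->
    (forall z, z \notin rcons s x -> (d x y <= d x z)%E) ->
    nn_run d (rcons (rcons s x) y).

Definition nn_tour d s : Prop := nn_run d s /\ tour_on [set: V]%SET s.

Definition insert_at (i : nat) s (v : V) : seq V := take i s ++ v :: drop i s.

End Metric.

(* Given the instance d, [rule_init d] are the admissible initial vertex sets,
   and [rule_next d s] are the vertices that may be inserted next when s is the
   current tour.  Deterministic rules return singletons; larger sets leave the
   choice open, as for ties, randomized rules or rules depending on the history. *)
Record insertion_rule (R : realType) (V : finType) := InsertionRule {
  rule_init : (V -> V -> \bar R) -> {set {set V}} ;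
  rule_next : (V -> V -> \bar R) -> seq V -> {set V} }.

Section Insertion.
Context {R : realType} {V : finType}.
Implicit Types (rule : insertion_rule R V) (d : V -> V -> \bar R).

(* As the length of the current tour s is fixed, a cheapest insertion is one that
   minimizes the length of the new tour; this avoids subtracting infinities. *)
Inductive insertion_run rule d : seq V -> Prop :=
| insertion_start (S : {set V}) s :
    S != finset.set0 -> S \in rule_init rule d -> optimal_tour_on d S s ->
    insertion_run rule d s
| insertion_step s v i :
    insertion_run rule d s -> v \notin s -> v \in rule_next rule d s ->
    (forall j, (tour_length d (insert_at i s v)
                <= tour_length d (insert_at j s v))%E) ->
    insertion_run rule d (insert_at i s v).

Definition insertion_tour rule d (s : seq V) : Prop :=
  insertion_run rule d s /\ tour_on [set: V]%SET s.

End Insertion.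

(* If the graph is disconnected then all tours have length +oo, and the ratio
   is set to 1. *)
Definition ratio_to {R : realType} (t a : \bar R) : \bar R :=
  if t == +oo%E then 1%E else (a / t)%E.

Definition mutually_independent {R : realType} {disp : measure_display}
    {T : measurableType disp} (P : probability T R) {I : finType}
    (F : I -> set (set T)) : Prop :=
  forall (J : {set I}) (A : I -> set T),
    (forall i, i \in J -> F i (A i)) ->
    P (\bigcap_(i in [set` J]) A i) = (\prod_(i in J) P (A i))%E.

Definition vpair (n : nat) := {e : {set 'I_n} | #|e| == 2%N}.

Section Model.
Context {R : realType} {disp : measure_display} {T : measurableType disp}.
Context (P : probability T R) {n : nat}.
Implicit Types (G : T -> {set {set 'I_n}}) (w : {set 'I_n} -> {RV P >-> R}).

(* The sigma-algebras generated by the presence of the edge e (inl e) and by the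
   weight of e (inr e). *)
Definition edge_events G w (k : vpair n + vpair n) : set (set T) :=
  match k with
  | inl e => preimage_set_system setT (fun t => val e \in G t) measurable
  | inr e => preimage_set_system setT (w (val e)) measurable
  end.

(* G is a G(n, p) random graph with independent Exp(1) edge weights.  Weights are
   attached to all pairs of vertices, independently of the graph; those of
   non-edges are never used by [sp_dist]. *)
Record erdos_renyi_exp (p : R) G w : Prop := ErdosRenyiExp {
  er_simple : forall t e, e \in G t -> #|e| = 2%N ;
  er_measurable : forall e : vpair n, measurable [set t | val e \in G t] ;
  er_prob : forall e : vpair n, P [set t | val e \in G t] = p%:E ;
  er_weight : forall (e : vpair n) (A : set R), measurable A ->
    distribution P (w (val e)) A = exponential_prob 1 A ;
  er_independent : mutually_independent P (edge_events G w) }.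

End Model.

Definition is_O1 {R : realType} (u : nat -> \bar R) : Prop :=
  exists C : R, \forall n \near \oo, (`|u n| <= C%:E)%E.

(* Main.v *)
Require Import Defs.
From HB Require Import structures.
From mathcomp Require Import all_boot all_order all_algebra.
From mathcomp Require Import all_classical all_reals all_analysis.
From mathcomp Require Import measurable_realfun ring lra zify.
Set Implicit Arguments.
Unset Strict Implicit.
Unset Printing Implicit Defensive.
Import Order.TTheory GRing.Theory Num.Theory.
Import numFieldNormedType.Exports.
Local Open Scope classical_set_scope.
Local Open Scope ring_scope.

(* The nearest-neighbor and the insertion heuristic both produce tours of length
   at most TSP + 2 * sum_v f v, where f v is the distance from v to some vertex
   and min (f u) (f v) <= d u v for u != v: vertices with f > 2r are pairwise at
   distance more than 2r, so the balls of radius r around them are disjoint.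
   Keep only the edges of weight at most b.  By a union bound over pairs of
   vertex sets without an edge between them, with probability 1 - O(1/n) this
   graph expands at all scales b ~ 16^k/(np) <= 1: three hops take every set of
   at least n/512^k vertices to more than n/2 vertices, so fewer than about
   n/512^k vertices have f v > 6b.  For b = 8 all sets double, so the diameter
   is O(log n), which is O(np).  Summing over the scales, sum_v f v is at most
   C/p + C * TSP.
   Conversely TSP >= const/p, since most vertices have all their edges heavier
   than const/(np).  So the ratio is bounded outside an event of probability
   O(1/n), on which it is at most n, as no distance exceeds TSP. *)

(** * Walks and cycles *)

Section Walks.
Context {R : realType} {V : finType}.
Implicit Types (D : V -> V -> R) (s p q : seq V).

Definition pseudometric D : Prop :=
  [/\ forall x, D x x = 0, forall x y, 0 <= D x y, forall x y, D x y = D y x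
    & forall x y z, D x z <= D x y + D y z].

Fixpoint walk_length D x p : R :=
  if p is y :: p' then D x y + walk_length D y p' else 0.

Definition cycle_length D s : R :=
  if s is x :: p then walk_length D x (rcons p x) else 0.

Lemma walk_length_cat D x p q :
  walk_length D x (p ++ q) = walk_length D x p + walk_length D (last x p) q.
Proof. by elim: p x => [|y p IH] x /=; rewrite ?add0r // IH addrA. Qed.

Lemma walk_length_rcons D x p y :
  walk_length D x (rcons p y) = walk_length D x p + D (last x p) y.
Proof. by rewrite -cats1 walk_length_cat /= addr0. Qed.

(** Links the successor function [next] of [tour_length] to the closing walk [rcons p x] of
    [cycle_length]. *)
Lemma next_map_cons x p : uniq (x :: p) -> map (next (x :: p)) (x :: p) = rcons p x.
Proof.
move=> us; apply: (@eq_from_nth _ x) => [|i]; rewrite size_map ?size_rcons //.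
move=> lti; rewrite (nth_map x) // next_nth mem_nth //.
rewrite index_uniq // nth_rcons; move: lti => /=; rewrite ltnS leq_eqVlt.
case/orP=> [/eqP->|lti]; last by rewrite lti; apply: set_nth_default.
(* Here the index is [size p]: [nth] past the end returns its default [x], the head to which the
   cycle returns. *)
by rewrite ltnn eqxx nth_default.
Qed.

Lemma walk_lengthE D x p :
  walk_length D x p = \sum_(u <- zip (belast x p) p) D u.1 u.2.
Proof. by elim: p x => [|y p IH] x /=; rewrite ?big_nil // big_cons IH. Qed.

Lemma tour_lengthE (d : V -> V -> \bar R) D s :
  (forall u v, d u v = (D u v)%:E) -> uniq s ->
  tour_length d s = (cycle_length D s)%:E.
Proof.
move=> dE us; rewrite /tour_length.
under eq_bigr do rewrite dE.
rewrite sumEFin; congr EFin; case: s us => [|x p] us; first by rewrite big_nil.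
rewrite /cycle_length walk_lengthE belast_rcons -(next_map_cons us).
have -> : zip (x :: p) (map (next (x :: p)) (x :: p))
        = map (fun y => (y, next (x :: p) y)) (x :: p).
  by rewrite -{1}(map_id (x :: p)) zip_map.
by rewrite big_map.
Qed.

Lemma cycle_length_rot D s1 s2 : cycle_length D (s1 ++ s2) = cycle_length D (s2 ++ s1).
Proof.
case: s1 => [|x1 p1]; first by rewrite cats0.
case: s2 => [|x2 p2]; first by rewrite cats0.
by rewrite /= !rcons_cat /= !walk_length_cat /= !walk_length_rcons; ring.
Qed.

Lemma walk_length_subseq D x y p q : pseudometric D -> subseq p q ->
  walk_length D x (rcons p y) <= walk_length D x (rcons q y).
Proof.
case=> D0 Dge0 Dsym Dtri; elim: q x p => [|b q IH] x [|a p] //= spq.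
  have := IH b [::] (sub0seq q); rewrite /= addr0 => H.
  by rewrite addr0; apply: le_trans (Dtri x b y) _; rewrite lerD2l.
move: spq; case: eqP => [<-|_] spq; first by rewrite lerD2l IH.
have /= := IH b (a :: p) spq => H; apply: le_trans (_ : _ <= D x b + (D b a + walk_length D a (rcons p y))) _.
  by rewrite addrA lerD2r Dtri.
by rewrite lerD2l.
Qed.

(** A subsequence may miss the head of [q]; rotating the cycle to start at the head of [p] reduces
    the claim to walks with equal endpoints, where dropped vertices are bypassed by the triangle
    inequality. *)
Lemma cycle_length_subseq D p q : pseudometric D -> subseq p q ->
  cycle_length D p <= cycle_length D q.
Proof.
move=> mD; case: p => [|x p] spq.
  have [_ Dge0 _ _] := mD.
  have w_ge0 r a : 0 <= walk_length D a r.
    by elim: r a => //= b r IH a; rewrite addr_ge0.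
  by case: q {spq} => /=.
suff [a [b [-> sb]]] : exists a b, q = a ++ x :: b /\ subseq p b.
  rewrite cycle_length_rot cat_cons /=; apply: walk_length_subseq => //.
  exact: subseq_trans sb (prefix_subseq _ _).
elim: q spq => [|y q IH] //=; case: eqP => [<-|_] spq.
  by exists [::], q.
by have [a [b [-> sb]]] := IH spq; exists (y :: a), b.
Qed.

(** After rotation, the cycle through [u] and [v] alone is a subsequence of [s], and it already
    costs at least [D u v]. *)
Lemma dist_le_cycle_length D s u v : pseudometric D -> u \in s -> v \in s ->
  D u v <= cycle_length D s.
Proof.
move=> mD; have [D0 Dge0 _ _] := mD.
move=> us; case/splitPr: us => s1 s2; rewrite cycle_length_rot cat_cons.
rewrite mem_cat inE orbCA -mem_cat => vs.
have [->|uv] := eqVneq u v.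
  have := @cycle_length_subseq D [::] (v :: s2 ++ s1) mD isT.
  by rewrite D0.
have {}vs : v \in s2 ++ s1.
  by move: vs; rewrite eq_sym (negbTE uv) /= !mem_cat orbC.
apply: le_trans (_ : cycle_length D [:: u; v] <= _).
  by rewrite /= lerDl addr0.
apply: cycle_length_subseq => //=; rewrite eqxx.
by rewrite sub1seq.
Qed.

(** A detour from [x] to [v] and back costs [2 * D x v]; the triangle inequality shortcuts the way
    back. *)
Lemma cycle_length_insert D s1 s2 x v : pseudometric D ->
  cycle_length D (s1 ++ x :: v :: s2)
  <= cycle_length D (s1 ++ x :: s2) + 2 * D x v.
Proof.
case=> D0 Dge0 Dsym Dtri; rewrite !(cycle_length_rot D s1) /=.
case: (s2 ++ s1) => [|y q] /=.
  by rewrite !addr0 D0 add0r (Dsym v x) mulr2n mulrDl mul1r.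
have := Dtri v x y; rewrite (Dsym v x); lra.
Qed.

End Walks.

(** * Separated functions bound the heuristics *)

Section Heuristics.
Context {R : realType} {V : finType}.
Implicit Types (d : V -> V -> \bar R) (D : V -> V -> R) (s p : seq V) (f : V -> R).

(** The second clause lets [f] inherit every upper bound on distances; the third keeps vertices with
    large [f] far apart. *)
Definition separated D f : Prop :=
  [/\ forall v, 0 <= f v, forall v, exists u, f v <= D v u
    & forall u v, u != v -> Num.min (f u) (f v) <= D u v].

Lemma separated0 D : pseudometric D -> separated D (fun=> 0).
Proof.
case=> D0 Dge0 Dsym Dtri; split=> // [v|u v _]; last by rewrite minxx.
by exists v.
Qed.

(** Vertices with [f y = 0] impose nothing, distances being nonnegative, so the new value at [v] is
    tested only against the support of [f]. *)
Lemma separated_update D f v u : pseudometric D -> separated D f ->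
  (forall y, f y != 0 -> Num.min (D v u) (f y) <= D v y) ->
  separated D (fun y => if y == v then D v u else f y).
Proof.
case=> D0 Dge0 Dsym _ [f0 fle fmin] fv; split=> [y|y|x y xy]; try by case: ifP.
  by case: eqP => [->|_] //; exists u.
have H z : Num.min (D v u) (f z) <= D v z.
  by have [->|/fv//] := eqVneq (f z) 0; rewrite ge_min Dge0 orbT.
case: eqP => [xv|_]; case: eqP => [yv|_]; last exact: fmin.
- by move: xy; rewrite xv yv eqxx.
- by rewrite xv.
- by rewrite yv minC (Dsym x).
Qed.

Lemma sum_update f v c : f v = 0 ->
  \sum_y (if y == v then c else f y) = \sum_y f y + c.
Proof.
move=> fv; rewrite (bigD1 v) //= eqxx [in RHS](bigD1 v) //= fv add0r addrC.
by congr (_ + _); apply: eq_bigr => y /negbTE ->.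
Qed.

(** Here [f v] is the length of the step by which the run leaves [v]. Any vertex visited later was
    still available at that moment, so it is at distance at least [f v] from [v]. *)
Lemma nn_run_separated d D s : pseudometric D ->
  (forall u v, d u v = (D u v)%:E) -> nn_run d s ->
  exists x p f, [/\ s = x :: p, separated D f & walk_length D x p <= \sum_v f v].
Proof.
move=> mD dE; have [D0 Dge0 Dsym Dtri] := mD.
(* The last vertex has no outgoing step yet, so [f] vanishes there; the comparison with it is
   recorded apart because it is no longer unvisited when it receives its value. *)
suff main : nn_run d s -> exists x p f,
  [/\ s = x :: p, separated D f & walk_length D x p <= \sum_v f v] /\
  [/\ forall v, v \notin s -> f v = 0, f (last x p) = 0,
      forall v, v \in s -> f v <= D v (last x p)
    & forall v y, v \in s -> y \notin s -> f v <= D v y].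
  by move=> /main[x [p [f [H _]]]]; exists x, p, f.
elim=> [v0|{}s x y _ [x0 [p [f [[sE sf wf] [fN fl flast fout]]]]] yN ymin].
  exists v0, [::], (fun=> 0); split; split=> //=.
  - exact: separated0.
  - by rewrite big1.
have xE : last x0 p = x by have := last_rcons x0 s x; rewrite sE.
rewrite xE in fl flast; have xs : x \in rcons s x by rewrite mem_rcons mem_head.
have yx : y != x by apply: contraNneq yN => ->.
exists x0, (rcons p y), (fun v => if v == x then D x y else f v).
rewrite last_rcons; split; split.
- by rewrite sE.
- apply: separated_update => // v fv0; rewrite ge_min.
  by rewrite (Dsym x v) flast ?orbT //; apply: contra_neqT fv0 => /fN.
- by rewrite walk_length_rcons xE sum_update // lerD2r.
- move=> v; rewrite mem_rcons inE negb_or => /andP[_ vN].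
  by case: eqP => [vx|_]; [rewrite vx xs in vN|exact: fN].
- by rewrite (negbTE yx); exact: fN.
- move=> v; rewrite mem_rcons inE => /orP[/eqP->|vs].
    by rewrite (negbTE yx) fN.
  by case: eqP => [->//|_]; exact: fout.
- move=> v z; rewrite mem_rcons inE => vs.
  rewrite mem_rcons inE negb_or => /andP[_ zN].
  case: eqP => [->|/eqP vx]; first by have := ymin z zN; rewrite !dE lee_fin.
  by case/orP: vs => [/eqP->|vs]; [rewrite fN|exact: fout].
Qed.

(** Here [f v] is the distance from [v] to the tour into which it is inserted, and zero for initial
    vertices. Inserting next to the nearest tour vertex adds at most [2 * f v], and the cheapest
    position adds no more. *)
Lemma insertion_run_separated rule d D T0 s : pseudometric D ->
  (forall u v, d u v = (D u v)%:E) ->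
  (forall S p, optimal_tour_on d S p -> cycle_length D p <= T0) ->
  insertion_run rule d s ->
  exists f, separated D f /\ cycle_length D s <= T0 + 2 * \sum_v f v.
Proof.
move=> mD dE hT; have [D0 Dge0 Dsym Dtri] := mD.
suff main : insertion_run rule d s -> exists f,
  [/\ separated D f, cycle_length D s <= T0 + 2 * \sum_v f v,
    uniq s, (0 < size s)%N & forall v, v \notin s -> f v = 0].
  by move=> /main[f [sf fl _ _ _]]; exists f.
elim=> [S {}s Sn0 _ os|{}s v i _ [f [sf fl us s0 fN]] vN _ imin].
  exists (fun=> 0); split=> //; first exact: separated0.
  - by rewrite big1 // mulr0 addr0; exact: hT os.
  - by case: os => -[].
  - case: os => -[_ sS] _; case: s sS => // sS.
    by case/set0Pn: Sn0 => x; rewrite -sS.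
have uI j : uniq (insert_at j s v).
  rewrite /insert_at (perm_uniq (s2 := v :: s)) /= ?vN //.
  by rewrite -cat1s perm_catCA cat1s perm_cons cat_take_drop.
case: s s0 => // x1 s1 _ in us vN imin uI fl fN *; set s := x1 :: s1 in us vN imin uI fl fN *.
have [x xs xmin] : exists2 x, x \in s & forall y, y \in s -> D v x <= D v y.
  case: (@arg_minP _ _ _ x1 (mem s) (D v)) => [|x xs xmin]; first exact: mem_head.
  by exists x.
exists (fun y => if y == v then D v x else f y); split=> //.
- apply: separated_update => // y fy0; rewrite ge_min xmin //.
  by apply: contra_neqT fy0 => /fN.
- rewrite sum_update ?fN // mulrDr addrA.
  apply: le_trans (_ : cycle_length D s + 2 * D v x <= _); last by rewrite lerD2r.
  (* This position places [v] right after its nearest tour vertex [x]. *)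
  have := imin (index x s).+1; rewrite !(tour_lengthE dE) // lee_fin => h.
  apply: le_trans h _; rewrite /insert_at.
  have sE : s = take (index x s) s ++ x :: drop (index x s).+1 s.
    by rewrite -{1}(cat_take_drop (index x s) s) (drop_nth x) ?index_mem // nth_index.
  rewrite (take_nth x) ?index_mem // nth_index // cat_rcons.
  by rewrite (Dsym v x) [X in _ <= cycle_length D X + _]sE; exact: cycle_length_insert.
- by rewrite /insert_at size_cat /= addnS.
- move=> y yN; have [yE|yv] := eqVneq y v.
    by case/negP: yN; rewrite yE /insert_at mem_cat mem_head orbT.
  apply: fN; apply: contra yN => ys.
  by rewrite /insert_at mem_cat in_cons orbCA -mem_cat cat_take_drop ys orbT.
Qed.

(** Restricting a full tour to [S] gives a tour on [S] that is no longer; this bounds the initial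
    tour of the insertion heuristic. *)
Lemma optimal_tour_le d D S p s : pseudometric D ->
  (forall u v, d u v = (D u v)%:E) -> optimal_tour_on d S p ->
  tour_on [set: V]%SET s -> cycle_length D p <= cycle_length D s.
Proof.
move=> mD dE [[up pS] popt] [us sT].
have /popt : tour_on S [seq x <- s | x \in S].
  split; first exact: filter_uniq.
  by move=> x; rewrite mem_filter sT finset.in_setT andbT.
rewrite !(tour_lengthE dE) ?filter_uniq // lee_fin => /le_trans; apply.
by apply: cycle_length_subseq => //; exact: filter_subseq.
Qed.

End Heuristics.

(** * Shortest path distances *)

Section ShortestPaths.
Context {R : realType} {V : finType}.
Variables (E : {set {set V}}) (w : {set V} -> R).
Hypothesis w_ge0 : forall e, e \in E -> 0 <= w e.
Implicit Types (u v x y : V) (p : seq V) (e : {set V}) (s : seq V).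

Lemma path_weight_cons u x p :
  path_weight w u (x :: p) = w [set u; x]%SET + path_weight w x p.
Proof. by rewrite /path_weight /= big_cons. Qed.

Lemma path_weight_cat u p1 p2 : path_weight w u (p1 ++ p2)
  = path_weight w u p1 + path_weight w (last u p1) p2.
Proof. by rewrite /path_weight pairmap_cat big_cat. Qed.

Lemma path_weight_ge0 u p : path (Defs.adjacent E) u p -> 0 <= path_weight w u p.
Proof.
elim: p u => [|x p IH] u /=; first by rewrite /path_weight big_nil.
by case/andP=> ux xp; rewrite path_weight_cons addr_ge0 ?w_ge0 ?IH.
Qed.

(** Nonnegative weights allow cycles to be cut out. This matters because [sp_dist] ranges over
    simple paths, whereas concatenated paths may repeat vertices. *)
Lemma simple_path_le u p : path (Defs.adjacent E) u p ->
  exists q, [/\ path (Defs.adjacent E) u q, last u q = last u p, uniq (u :: q)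
    & path_weight w u q <= path_weight w u p].
Proof.
elim: p u => [|x p IH] u; first by exists [::].
case/andP=> ux /IH[q [xq lq uq wq]] /=.
have [uxq|uxq] := boolP (u \in x :: q).
  case/splitPl: uxq xq lq uq wq => a b lastE.
  rewrite cat_path last_cat path_weight_cat path_weight_cons lastE.
  move=> /andP[xa ub] lq uq wq; exists b; split=> //.
    move: uq; rewrite -cat_cons lastI lastE cat_rcons cat_uniq.
    by case/and3P.
  have := path_weight_ge0 xa; have := w_ge0 ux; lra.
exists (x :: q); split=> //=; first by rewrite ux.
  by rewrite uxq.
by rewrite !path_weight_cons lerD2l.
Qed.

Lemma sp_dist_le u p : path (Defs.adjacent E) u p ->
  (sp_dist E w u (last u p) <= (path_weight w u p)%:E)%E.
Proof.
case/simple_path_le=> q [uq lq nq wq].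
apply: le_trans (_ : _ <= (path_weight w u q)%:E)%E _; last by rewrite lee_fin.
by apply: ereal_inf_lbound; exists q.
Qed.

Lemma sp_dist_edge x y : [set x; y]%SET \in E ->
  (sp_dist E w x y <= (w [set x; y]%SET)%:E)%E.
Proof.
move=> xy; have := @sp_dist_le x [:: y].
by rewrite /= path_weight_cons /path_weight big_nil addr0 andbT; apply.
Qed.

Lemma sp_dist_ge0 u v : (0 <= sp_dist E w u v)%E.
Proof.
apply: le_ereal_inf_tmp => _ [p [up _ _] <-].
by rewrite lee_fin path_weight_ge0.
Qed.

Lemma sp_distxx u : sp_dist E w u u = 0%E.
Proof.
apply/eqP; rewrite eq_le sp_dist_ge0 andbT.
by have := @sp_dist_le u [::] isT; rewrite /path_weight big_nil.
Qed.

Lemma path_weight_rev u p : path_weight w (last u p) (rev (belast u p))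
  = path_weight w u p.
Proof.
elim: p u => [|x p IH] u //=.
rewrite rev_cons -cats1 path_weight_cat IH [RHS]path_weight_cons addrC.
congr (_ + _).
suff -> : last (last x p) (rev (belast x p)) = x.
  by rewrite path_weight_cons /path_weight big_nil addr0 finset.setUC.
by case: p {IH} => //= y p; rewrite rev_cons last_rcons.
Qed.

Lemma sp_dist_sym_le u v : (sp_dist E w u v <= sp_dist E w v u)%E.
Proof.
apply: le_ereal_inf_tmp => _ [p [vp lp _] <-].
rewrite -path_weight_rev -lp; have {2}<- : last (last v p) (rev (belast v p)) = v.
  by case: (p) => //= y q; rewrite rev_cons last_rcons.
apply: sp_dist_le; rewrite rev_path.
by apply: sub_path vp => x y; rewrite /Defs.adjacent finset.setUC.
Qed.

Lemma sp_distC u v : sp_dist E w u v = sp_dist E w v u.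
Proof. by apply/eqP; rewrite eq_le !sp_dist_sym_le. Qed.

Lemma sp_dist_triangle x y z :
  (sp_dist E w x z <= sp_dist E w x y + sp_dist E w y z)%E.
Proof.
have := sp_dist_ge0 x y; case dxy: (sp_dist E w x y) => [a||] // a0; last first.
  by rewrite addye ?leey //; case: (sp_dist E w y z) (sp_dist_ge0 y z).
have := sp_dist_ge0 y z; case dyz: (sp_dist E w y z) => [b||] // b0; last first.
  by rewrite addey ?leey.
apply/lee_addgt0Pr => e e0.
have e20 : 0 < e / 2 by rewrite divr_gt0.
have [|_ [p [xp lp _] <-] wp] := @lb_ereal_inf_adherent R _ _ e20 (_ : sp_dist E w x y \is a fin_num).
  by rewrite dxy.
have [|_ [q [yq lq _] <-] wq] := @lb_ereal_inf_adherent R _ _ e20 (_ : sp_dist E w y z \is a fin_num).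
  by rewrite dyz.
have := @sp_dist_le x (p ++ q).
rewrite cat_path last_cat path_weight_cat lp xp yq lq => /(_ isT) /le_trans; apply.
move: wp wq; rewrite -/(sp_dist E w x y) -/(sp_dist E w y z) dxy dyz.
rewrite -!EFinD !lte_fin lee_fin; lra.
Qed.

Lemma sp_dist_isolated (b : R) u v : u != v ->
  (forall e, e \in E -> u \in e -> b <= w e) -> (b%:E <= sp_dist E w u v)%E.
Proof.
move=> uv hb; apply: le_ereal_inf_tmp => _ [[|x p] /= [up lp _] <-].
  by rewrite lp eqxx in uv.
case/andP: up => ux xp; rewrite lee_fin path_weight_cons.
have := path_weight_ge0 xp; have := hb _ ux; rewrite set21 => /(_ isT); lra.
Qed.

(** Each step of a finite tour is finite and the tour meets every vertex, so by the triangle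
    inequality all distances are finite. *)
Lemma finite_tour_sp_dist s : tour_on [set: V]%SET s ->
  (tour_length (sp_dist E w) s < +oo)%E ->
  exists2 D : V -> V -> R, pseudometric D & forall u v, sp_dist E w u v = (D u v)%:E.
Proof.
move=> [us sT] s_fin; pose d := sp_dist E w.
have step x : (d x (next s x) < +oo)%E.
  apply: le_lt_trans s_fin; rewrite /tour_length (bigD1_seq x) ?sT ?finset.in_setT //=.
  by rewrite leeDl // sume_ge0 // => y _; exact: sp_dist_ge0.
have dfin x y : (d x y < +oo)%E.
  have : cycle (fun a b => (d a b < +oo)%E) s by apply: cycle_from_next => // z _.
  have : y \in s by rewrite sT finset.in_setT.
  have : x \in s by rewrite sT finset.in_setT.
  case: s {us sT s_fin step} => // a p ap yp /=.
  rewrite rcons_path => /andP[aPath _].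
  suff H z : z \in a :: p -> (d a z < +oo)%E.
    apply: le_lt_trans (sp_dist_triangle x a y) _.
    by rewrite lte_add_pinfty ?H // sp_distC H.
  rewrite inE => /orP[/eqP->|]; first by rewrite /d sp_distxx.
  elim: p a aPath {ap yp} => // b p IH a /= /andP[ab bp].
  rewrite inE => zp; apply: le_lt_trans (sp_dist_triangle a b z) _.
  rewrite lte_add_pinfty //; case/orP: zp => [/eqP->|/(IH _ bp)//].
  by rewrite sp_distxx.
have dE u v : sp_dist E w u v = (fine (d u v))%:E.
  by rewrite fineK // ge0_fin_numE // sp_dist_ge0.
exists (fun u v => fine (d u v)) => //; split=> [x|x y|x y|x y z].
- by rewrite /d sp_distxx.
- by rewrite fine_ge0 // sp_dist_ge0.
- by rewrite /d sp_distC.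
- by rewrite -lee_fin EFinD -!dE sp_dist_triangle.
Qed.

End ShortestPaths.

(** * Expansion and packing *)

Section Expansion.
Context {R : realType} {V : finType}.
Implicit Types (H : {set {set V}}) (A : {set V}) (D : V -> V -> R) (f : V -> R).

Definition nbh H A : {set V} :=
  (A :|: [set y | [exists x in A, [set x; y]%SET \in H]])%SET.

(** The strict inequality explains the form [expands H s s.*2.-1] used for doubling when [s] is
    positive. *)
Definition expands H (a c : nat) : Prop :=
  forall A, (a <= #|A|)%N -> (c < #|nbh H A|)%N.

Lemma nbh_sub H A : A \subset nbh H A.
Proof. exact: finset.subsetUl. Qed.

Lemma iter_nbh_dist H D b r A y : pseudometric D ->
  (forall x z, [set x; z]%SET \in H -> D x z <= b) -> 0 <= b ->
  y \in iter r (nbh H) A -> exists2 x, x \in A & D x y <= r%:R * b.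
Proof.
case=> D0 _ _ Dtri hb b0; elim: r y => [|r IH] y /=.
  by exists y => //; rewrite D0 mul0r.
rewrite finset.in_setU finset.in_set -natr1 mulrDl mul1r => /orP[/IH[x xA xy]|].
  by exists x => //; rewrite (le_trans xy) // lerDl.
case/exists_inP=> z /IH[x xA xz] zy; exists x => //.
by apply: le_trans (Dtri x z y) _; rewrite lerD ?hb.
Qed.

(** Each hop doubles the set until its size exceeds [m]; afterwards it cannot shrink, since
    [nbh H B] contains [B]. *)
Lemma iter_nbh_ge H m A i : (forall s, (0 < s <= m)%N -> expands H s s.*2.-1) ->
  (0 < #|A|)%N -> (minn (2 ^ i) m.+1 <= #|iter i (nbh H) A|)%N.
Proof.
move=> hH A0; elim: i => [|i IH] /=; first by rewrite geq_min expn0 A0.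
set B := iter i _ _ in IH *; have Bsub := subset_leq_card (nbh_sub H B).
have [Bm|mB] := leqP #|B| m; last by rewrite geq_min orbC (leq_trans mB).
have B0 : (0 < #|B|)%N.
  by apply: leq_trans IH; rewrite leq_min expn_gt0.
have /(_ B (leqnn _)) : expands H #|B| #|B|.*2.-1 by apply: hH; rewrite B0.
rewrite prednK ?double_gt0 // => h; apply: leq_trans h.
move: IH; rewrite !geq_min => /orP[h|]; last by rewrite ltnNge Bm.
by rewrite expnS mul2n leq_double h.
Qed.

(** Both reached sets contain more than half of the vertices, so they share a vertex [z], through
    which the path goes. *)
Lemma reach_meet D (B : {set V} -> {set V}) rho a A1 A2 : pseudometric D ->
  (forall A, (a <= #|A|)%N -> (#|V| < #|B A|.*2)%N) ->
  (forall A y, y \in B A -> exists2 x, x \in A & D x y <= rho) ->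
  (a <= #|A1|)%N -> (a <= #|A2|)%N ->
  exists x1 x2, [/\ x1 \in A1, x2 \in A2 & D x1 x2 <= 2 * rho].
Proof.
case=> _ _ Dsym Dtri hB hD /hB h1 /hB h2.
have /card_gt0P[z] : (0 < #|B A1 :&: B A2|)%N.
  have := finset.cardsUI (B A1) (B A2); have := max_card (B A1 :|: B A2).
  by move: h1 h2; lia.
rewrite finset.in_setI => /andP[/hD[x1 x1A x1z] /hD[x2 x2A x2z]].
exists x1, x2; split=> //; apply: le_trans (Dtri x1 z x2) _.
by rewrite mulr2n mulrDl mul1r lerD // Dsym.
Qed.

(** Among [a.*2] vertices with [f > 2 * rho] there would be two disjoint sets of at least [a]
    vertices. Their reaches meet, giving two distinct such vertices within [2 * rho], against
    separation. *)
Lemma card_separated_gt D f (B : {set V} -> {set V}) rho a : pseudometric D ->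
  (forall A, (a <= #|A|)%N -> (#|V| < #|B A|.*2)%N) ->
  (forall A y, y \in B A -> exists2 x, x \in A & D x y <= rho) ->
  separated D f -> (#|[set v | (2 * rho < f v)%R]%SET| < a.*2)%N.
Proof.
move=> mD hB hD [f0 _ fmin]; rewrite ltnNge; apply/negP => hP.
set P := [set v | _]%SET in hP.
have [A1 sA1 cA1] : exists2 A1 : {set V}, A1 \subset P & #|A1| = a.
  have /card_geqP[s [us ss sP]] : (a <= #|P|)%N by apply: leq_trans hP; lia.
  exists [set x in s]%SET; first by apply/fintype.subsetP => x; rewrite finset.in_set => /sP.
  by rewrite cardsE (card_uniqP us).
have cA2 : (a <= #|P :\: A1|)%N.
  by rewrite finset.cardsD (finset.setIidPr sA1) cA1; lia.
have cA1' : (a <= #|A1|)%N by rewrite cA1.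
have [x1 [x2 [x1A]]] := reach_meet mD hB hD cA1' cA2.
rewrite finset.in_setD => /andP[x2N x2P] x12.
have x1P := fintype.subsetP sA1 _ x1A; rewrite !finset.in_set in x1P x2P.
have x12N : x1 != x2 by apply: contraNneq x2N => <-.
have := le_trans (fmin _ _ x12N) x12.
by rewrite ge_min !leNgt x1P x2P.
Qed.

End Expansion.

(* At scale k the edge weights are at most h * 16 ^ k with h = const / (n p).
   Three hops take sets of size scale_size n 3 k to sizes scale_size n v k for
   v = 2, 1, 0, the last one exceeding n / 2. *)
Definition scale_size (n v k : nat) : nat := (n %/ 2 ^ (3 * v * k).+1).+1.

(** Vertices with [f] between [T j] and [T j.+1] contribute at most [T j.+1] each; those above the
    last threshold stay as an explicit sum. *)
Lemma sum_layers {R : realType} {V : finType} (f : V -> R) (T : nat -> R) J :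
  (forall v, 0 <= f v) -> (forall j, 0 <= T j) ->
  \sum_v f v <= #|V|%:R * T 0%N + \sum_(j < J) T j.+1 * #|[set v | T j < f v]%R%SET|%:R
     + \sum_(v | T J < f v) f v.
Proof.
move=> f0 T0; elim: J => [|J IH].
  rewrite big_ord0 addr0 (bigID (fun v => T 0%N < f v)) /= addrC lerD2r.
  apply: le_trans (_ : \sum_(v | ~~ (T 0%N < f v)) T 0%N <= _).
    by apply: ler_sum => v; rewrite -leNgt.
  rewrite sumr_const -[_ *+ _]mulr_natl ler_wpM2r // ler_nat.
  exact: max_card.
apply: le_trans IH _; rewrite big_ord_recr /= -!addrA !lerD2l.
rewrite (bigID (fun v => T J.+1 < f v)) /= addrC; apply: lerD.
  apply: le_trans (_ : \sum_(v | T J < f v) T J.+1 <= _).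
    apply: le_trans (_ : \sum_(v | (T J < f v) && ~~ (T J.+1 < f v)) T J.+1 <= _).
      by apply: ler_sum => v /andP[_]; rewrite -leNgt.
    rewrite big_mkcondr /=; apply: ler_sum => v _.
    by case: ifP.
  by rewrite sumr_const -[_ *+ _]mulr_natr cardsE.
rewrite big_mkcond [leRHS]big_mkcond; apply: ler_sum => v _ /=.
by case: (T J < f v); case: (T J.+1 < f v) => /=.
Qed.

(** * Consequences of expansion: small superlevel sets and a logarithmic diameter *)

Section ExpansionConsequences.
Context {R : realType} {V : finType}.
Variables (D : V -> V -> R) (H : R -> {set {set V}}) (h : R) (K : nat).
Hypothesis mD : pseudometric D.
Hypothesis HD : forall b x y, [set x; y]%SET \in H b -> D x y <= b.
Hypothesis h0 : 0 <= h.
Local Notation n := #|V|.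
Hypothesis scales : forall k v, (0 < k <= K)%N -> (v < 3)%N ->
  expands (H (h * 16 ^+ k)) (scale_size n v.+1 k) (scale_size n v k).

Lemma card_separated_scale f k : separated D f -> (0 < k <= K)%N ->
  (#|[set v | (6 * (h * 16 ^+ k) < f v)%R]%SET| < (scale_size n 3 k).*2)%N.
Proof.
move=> sf kK; have -> : 6 * (h * 16 ^+ k) = 2 * (3%:R * (h * 16 ^+ k)) by ring.
have b0 : 0 <= h * 16 ^+ k by rewrite mulr_ge0 ?exprn_ge0.
apply: (card_separated_gt (B := iter 3 (nbh (H (h * 16 ^+ k)))) mD) => // [A hA|A y].
  have h3 := scales kK (isT : 2 < 3)%N hA.
  have h2 := scales kK (isT : 1 < 3)%N (ltnW h3).
  have h1 := scales kK (isT : 0 < 3)%N (ltnW h2).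
  (* At level [0] the exponent collapses: [scale_size n 0 k] is [(n %/ 2).+1] for every [k], which
     exceeds half of [n] in either parity. *)
  rewrite /= -[n]odd_double_half; move: h1; rewrite /scale_size muln0 mul0n expn1 divn2.
  by set B := #|_|; case: (odd n); lia.
exact: (iter_nbh_dist mD (@HD _) b0).
Qed.

(** From a single vertex, [L] doubling hops reach more than a quarter of the vertices, and one
    further hop at the first scale more than half; two such reaches meet. *)
Lemma diameter_le L b u v : (0 < K)%N -> (16 <= n)%N -> (n <= 2 ^ L)%N -> 0 <= b ->
  (forall s, (0 < s <= n %/ 4)%N -> expands (H b) s s.*2.-1) ->
  D u v <= 2 * (L%:R * b + h * 16).
Proof.
move=> K0 n16 nL b0 dbl.
have b1 : 0 <= h * 16 by rewrite mulr_ge0.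
pose B A := nbh (H (h * 16)) (iter L (nbh (H b)) A).
have hB (A : {set V}) : (1 <= #|A|)%N -> (n < #|B A|.*2)%N.
  move=> hA; have hL := iter_nbh_ge L dbl hA.
  have /(_ _) := @scales 1 0; rewrite K0 expr1 => /(_ isT isT) hs.
  have /hs : (scale_size n 1 1 <= #|iter L (nbh (H b)) A|)%N.
    (* The size needed for the last hop is [scale_size n 1 1 = (n %/ 16).+1]. *)
    apply: leq_trans hL; rewrite /scale_size leq_min; apply/andP; split.
      by apply: leq_trans nL; rewrite (_ : 2 ^ _ = 16)%N //; lia.
    by rewrite ltnS (_ : 2 ^ _ = 16)%N //; lia.
  by rewrite /scale_size muln0 mul0n expn1 -/(B A); lia.
have hD (A : {set V}) y : y \in B A -> exists2 x, x \in A & D x y <= L%:R * b + h * 16.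
  move=> yB; have := @iter_nbh_dist _ _ (H (h * 16)) D (h * 16) 1 _ y mD (@HD _) b1 yB.
  case=> z zB zy; have [x xA xz] := iter_nbh_dist mD (@HD b) b0 zB.
  have [_ _ _ Dtri] := mD; exists x => //; apply: le_trans (Dtri x z y) _.
  by rewrite lerD // -[h * 16]mul1r.
have [||x1 [x2 []]] := @reach_meet _ _ D B _ 1 [set u]%SET [set v]%SET mD hB hD.
- by rewrite finset.cards1.
- by rewrite finset.cards1.
by rewrite !finset.in_set1 => /eqP-> /eqP->.
Qed.

End ExpansionConsequences.

(** * The sum of a separated function *)

Lemma sum_inv_pow_le1 {R : realType} (x : R) J : 2 <= x ->
  \sum_(j < J) (x ^+ j.+1)^-1 <= 1.
Proof.
move=> x2; have x0 : 0 < x by lra.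
(* The subtracted term makes the bound inductive: halving at each step pays for the next summand. *)
suff : \sum_(j < J) (x ^+ j.+1)^-1 <= 1 - (x ^+ J)^-1.
  by move=> /le_trans; apply; rewrite gerBl invr_ge0 exprn_ge0 // ltW.
elim: J => [|J IH]; first by rewrite big_ord0 expr0 invr1 subrr.
rewrite big_ord_recr /=; apply: le_trans (lerD IH (lexx _)) _.
suff : (x ^+ J.+1)^-1 *+ 2 <= (x ^+ J)^-1.
  by move: (x ^+ J.+1)^-1 (x ^+ J)^-1 => a b; lra.
rewrite exprS invfM -mulr_natl -[leRHS]mul1r mulrA ler_wpM2r //.
  by rewrite invr_ge0 exprn_ge0 // ltW.
by rewrite ler_pdivrMr // mul1r.
Qed.

Lemma ln2_ge_half {R : realType} : 2^-1 <= ln 2 :> R.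
Proof.
rewrite -(ler_expR 2^-1) lnK ?posrE //.
have h : 2^-1 <= expR (- 2^-1) :> R by apply: le_trans (expR_ge1Dx _); lra.
rewrite -[leLHS]invrK -expRN -[leRHS]invrK lef_pV2 // ?posrE ?expR_gt0 //.
Qed.

(** Uses [2 ^ (up_log 2 n).-1 < n] and [ln 2 >= 1 / 2]. *)
Lemma up_log2_le {R : realType} n : (1 < n)%N -> (up_log 2 n)%:R <= 1 + 2 * ln n%:R :> R.
Proof.
move=> n1; have := @up_log_gtn 2 n isT n1.
have : (0 < up_log 2 n)%N by rewrite up_log_gt0 n1.
case: (up_log 2 n) => // m _ /= h.
rewrite -natr1 addrC lerD2l.
have : ln (2 ^+ m) <= ln n%:R :> R.
  by rewrite ler_ln ?posrE ?exprn_gt0 ?ltr0n ?(ltnW n1) // -natrX ler_nat ltnW.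
rewrite lnXn // -[_ *+ m]mulr_natl => hm.
have := @ln2_ge_half R => h2.
have : m%:R * 2^-1 <= m%:R * ln 2 :> R by rewrite ler_wpM2l.
lra.
Qed.

Section SeparatedSum.
Context {R : realType} {V : finType}.
Variables (D : V -> V -> R) (H : R -> {set {set V}}) (a p tsp : R) (K : nat).
Local Notation n := #|V|.
Local Notation h := (a / (n%:R * p)).
Hypothesis mD : pseudometric D.
Hypothesis HD : forall b x y, [set x; y]%SET \in H b -> D x y <= b.
Hypothesis scales : forall k v, (0 < k <= K)%N -> (v < 3)%N ->
  expands (H (h * 16 ^+ k)) (scale_size n v.+1 k) (scale_size n v k).
Hypothesis doubling :
  forall s, (0 < s <= n %/ 4)%N -> expands (H 8) s s.*2.-1.
Hypothesis Dtsp : forall u v, D u v <= tsp.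
Hypothesis (a0 : 0 < a) (p0 : 0 < p) (n16 : (16 <= n)%N).
Hypothesis (ln1 : 1 <= ln n%:R :> R) (npln : 9 * ln n%:R <= n%:R * p).
Hypothesis (K0 : (0 < K)%N) (Kn : (2 ^ (9 * K).+1 <= n)%N) (Kp : a * 16 ^+ K <= n%:R * p).
Hypothesis Kmax : (n < 2 ^ (9 * K.+1).+1)%N \/ n%:R * p < a * 16 ^+ K.+1.

Let n0 : 0 < n%:R :> R. Proof. by rewrite ltr0n; case: n n16. Qed.
Let np0 : 0 < n%:R * p. Proof. by rewrite mulr_gt0. Qed.
Let h0 : 0 < h. Proof. by rewrite divr_gt0. Qed.

Lemma card_separated_scale_le f k : separated D f -> (0 < k <= K)%N ->
  #|[set v | (6 * (h * 16 ^+ k) < f v)%R]%SET|%:R <= 2 * n%:R / 2 ^+ (9 * k) :> R.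
Proof.
move=> sf kK; have := card_separated_scale mD HD (ltW h0) scales sf kK.
set N := #|_|; rewrite /scale_size -[(3 * 3)%N]/9%N expnS.
rewrite ler_pdivlMr ?exprn_gt0 // -(natrX _ 2) -(natrM _ N) -(natrM _ 2) ler_nat.
have : (2 * 2 ^ (9 * k) <= n)%N.
  by apply: leq_trans Kn; rewrite -expnS leq_exp2l // ltnS leq_mul2l; case/andP: kK.
set y := (2 ^ (9 * k))%N => yn NN.
have q1 : (n %/ (2 * y) * (2 * y) <= n)%N by exact: leq_divM.
(* With [q = n %/ (2 * y)] the strict bound gives [N <= 2 q + 1]; after multiplication by [y], both
   [2 q y] and [y] are at most [n]. *)
have N2 : (N <= (n %/ (2 * y)).*2.+1)%N by rewrite -ltnS; move: NN; rewrite doubleS.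
apply: leq_trans (leq_mul N2 (leqnn y)) _.
rewrite mulSn -muln2 -mulnA [leqRHS]mul2n -addnn leq_add //.
by apply: leq_trans yn; rewrite leq_pmull.
Qed.

(** The layers below the last scale give [O(1 / p)]. The tail splits by [Kmax]: either fewer than
    2048 vertices remain, each costing at most [tsp], or [n p] is of order [16 ^+ K] and the
    diameter bound suffices. *)
Lemma sum_separated_le f : separated D f ->
  \sum_v f v <= (288 * a + 12 * (16 * a) ^+ 2) / p + 2048 * tsp.
Proof.
move=> sf; have [f0 fD _] := sf.
pose T j := 6 * (h * 16 ^+ j.+1).
have T0 j : 0 <= T j by rewrite !mulr_ge0 ?invr_ge0 ?exprn_ge0 // ltW.
have tsp0 : 0 <= tsp.
  case: (pickP V) => [u _|V0]; last by move: n16; rewrite eq_card0.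
  by apply: le_trans (Dtsp u u); have [-> _ _ _] := mD.
have KE : K.-1.+1 = K by rewrite prednK.
apply: le_trans (sum_layers K.-1 f0 T0) _.
have low : n%:R * T 0%N + \sum_(j < K.-1) T j.+1 * #|[set v | T j < f v]%R%SET|%:R
           <= 288 * a / p.
  (* The bottom layer [n * T 0] equals [96 * a / p]; the others sum to at most [192 * a / p]. *)
  have -> : 288 * a / p = n%:R * T 0%N + 192 * a / p * 1.
    by rewrite /T expr1; field; rewrite !gt_eqF.
  rewrite lerD2l; apply: le_trans (_ : 192 * a / p * \sum_(j < K.-1) (32 ^+ j.+1)^-1 <= _).
    rewrite mulr_sumr; apply: ler_sum => j _.
    apply: le_trans (_ : T j.+1 * (2 * n%:R / 2 ^+ (9 * j.+1)) <= _).
      rewrite ler_wpM2l //; apply: card_separated_scale_le => //=.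
      exact: leq_trans (ltn_ord j) (leq_pred K).
    (* Per scale, thresholds grow by 16 while counts fall by [2 ^ 9 = 16 * 32], which leaves a
       geometric series of ratio [1 / 32]. *)
    have -> : 2 ^+ (9 * j.+1) = 16 ^+ j.+1 * 32 ^+ j.+1 :> R.
      by rewrite exprM -exprMn; congr (_ ^+ _); ring.
    rewrite /T [16 ^+ j.+2]exprS le_eqVlt; apply/orP; left; apply/eqP; field.
    by rewrite !gt_eqF ?exprn_gt0.
  apply: ler_wpM2l; last by apply: sum_inv_pow_le1; lra.
  by apply: divr_ge0; [apply: mulr_ge0; [exact: ler0n|exact: ltW]|exact: ltW].
have ftsp v : f v <= tsp by have [u /le_trans] := fD v; apply.
have NK := card_separated_scale_le sf (_ : 0 < K <= K)%N.
rewrite K0 leqnn in NK; have {}NK := NK isT.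
have tail B : (forall v, f v <= B) -> 0 <= B ->
    \sum_(v | T K.-1 < f v) f v <= 2 * n%:R / 2 ^+ (9 * K) * B.
  move=> fB B0; apply: le_trans (_ : \sum_(v | T K.-1 < f v) B <= _).
    by apply: ler_sum => v _.
  rewrite sumr_const -[_ *+ _]mulr_natl; apply: ler_wpM2r => //.
  by apply: le_trans NK; rewrite /T KE cardsE.
have y0 : 0 < (2 : R) ^+ (9 * K) by rewrite exprn_gt0.
rewrite mulrDl -[leRHS]addrA; apply: (lerD low); case: Kmax => hK.
  have := tail tsp ftsp tsp0 => /le_trans; apply.
  have C0 : 0 <= 12 * (16 * a) ^+ 2 / p :> R by rewrite divr_ge0 ?mulr_ge0 ?exprn_ge0 // ltW.
  apply: le_trans (_ : 2048 * tsp <= _); last by rewrite lerDr.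
  rewrite ler_wpM2r // ler_pdivrMr //.
  move: hK; rewrite -(ltr_nat R) natrX mulnS exprS exprD.
  move: (2 ^+ (9 * K)) => y hK; lra.
pose dm : R := 2 * ((up_log 2 n)%:R * 8 + h * 16).
have fdm v : f v <= dm.
  have [u /le_trans] := fD v; apply.
  exact: (diameter_le mD HD (ltW h0) scales v u K0 n16 (up_logP n (isT : 1 < 2)%N) (ler0n R 8) doubling).
(* With [h * 16 <= 1] and [up_log 2 n <= 1 + 2 ln n], the diameter is at most [18 + 32 ln n], and
   [ln n >= 1]. *)
have dm_le : dm <= 50 * ln n%:R.
  have h1 : h * 16 <= 1.
    rewrite mulrAC ler_pdivrMr // mul1r; apply: le_trans Kp.
    apply: ler_wpM2l; first exact: ltW.
    by rewrite -[leLHS]expr1; apply: ler_weXn2l => //; lra.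
  have := @up_log2_le R n; rewrite (leq_trans _ n16) // => /(_ isT).
  by rewrite /dm; move: ln1; lra.
have dm0 : 0 <= dm by rewrite mulr_ge0 // addr_ge0 ?mulr_ge0 ?invr_ge0 // ltW.
apply: le_trans (tail dm fdm dm0) _.
apply: le_trans (_ : 12 * (16 * a) ^+ 2 / p <= _); last first.
  by rewrite lerDl; apply: mulr_ge0; [exact: ler0n|exact: tsp0].
apply: le_trans (_ : 2 * n%:R / 2 ^+ (9 * K) * (6 * (n%:R * p)) <= _).
  apply: ler_wpM2l; last by apply: le_trans dm_le _; move: npln ln1; lra.
  by apply: divr_ge0; [apply: mulr_ge0|]; apply: ltW.
have hz : n%:R * p <= (16 * a) * 16 ^+ K by move: hK; rewrite exprS; lra.
have z0 : 0 < (16 : R) ^+ K by rewrite exprn_gt0.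
(* Since [256 <= 512], the count in the tail outweighs the square of [n p]: one factor comes from
   the diameter, the other from writing [n] as [n p / p]. *)
have zy : (16 ^+ K) ^+ 2 <= 2 ^+ (9 * K) :> R.
  rewrite -exprM mulnC exprM [leRHS]exprM; apply: lerXn2r; rewrite ?nnegrE ?exprn_ge0 //.
  by lra.
have hz2 : (n%:R * p) ^+ 2 <= (16 * a) ^+ 2 * 2 ^+ (9 * K).
  apply: le_trans (_ : ((16 * a) * 16 ^+ K) ^+ 2 <= _).
    apply: lerXn2r hz; rewrite nnegrE; first exact: ltW.
    by apply: mulr_ge0; [apply: mulr_ge0|]; apply: ltW.
  by rewrite exprMn; apply: ler_wpM2l => //; rewrite exprn_ge0 // mulr_ge0 // ltW.
have -> : 2 * n%:R / 2 ^+ (9 * K) * (6 * (n%:R * p)) = 12 * ((n%:R * p) ^+ 2 / 2 ^+ (9 * K)) / p.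
  by field; rewrite !gt_eqF.
rewrite ler_wpM2r ?invr_ge0 ?(ltW p0) // ler_wpM2l //.
by rewrite ler_pdivrMr.
Qed.

End SeparatedSum.

(** * Ratios to the optimal tour *)

Section RatioBounds.
Context {R : realType} {V : finType}.
Variables (E : {set {set V}}) (w : {set V} -> R).
Hypothesis w_gt0 : forall e, e \in E -> 0 < w e.
Hypothesis V2 : (1 < #|V|)%N.
Implicit Types (s : seq V) (D : V -> V -> R).
Local Notation d := (sp_dist E w).

Let w_ge0 e : e \in E -> 0 <= w e. Proof. by move/w_gt0/ltW. Qed.

Lemma next_neq s x : uniq s -> (1 < size s)%N -> x \in s -> next s x != x.
Proof.
move=> us s2 /rot_to[i s' sE]; rewrite -(next_rot i us) sE.
have : uniq (rot i s) by rewrite rot_uniq.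
have : (1 < size (rot i s))%N by rewrite size_rot.
rewrite sE; case: s' {sE} => // y p _ /=; rewrite eqxx inE negb_or eq_sym.
by case/andP=> /andP[].
Qed.

Lemma size_tour s : tour_on [set: V]%SET s -> size s = #|V|.
Proof.
by case=> us sT; rewrite -(card_uniqP us) -cardsT; apply: eq_card.
Qed.

(** The light edges touch at most half of the vertices; a tour leaves each of the others at cost at
    least [b]. *)
Lemma tour_length_isolated (b : R) s : 0 <= b -> (forall e, e \in E -> #|e| = 2%N) ->
  (4 * #|[set e in E | (w e <= b)%R]%SET| <= #|V|)%N -> tour_on [set: V]%SET s ->
  ((b * (#|V|%:R / 2))%:E <= tour_length d s)%E.
Proof.
move=> b0 E2 Hcard sT; have sz := size_tour sT; have [us sV] := sT.
set H := [set e in E | _]%SET in Hcard.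
have cardC : (#|finset.cover H| <= 2 * #|H|)%N.
  apply: leq_trans (leq_card_cover H) _; rewrite -sum1_card big_distrr /= leq_sum // => e.
  by rewrite finset.in_set => /andP[/E2 ->].
have iso : (#|V| <= 2 * #|~: finset.cover H|)%N.
  by have := finset.cardsCs (finset.cover H); have := max_card (finset.cover H); lia.
rewrite /tour_length (eq_big_seq (fun x => d x (next s x))) //.
rewrite (big_uniq _ us) /=.
apply: le_trans (_ : _ <= \sum_(x in s) (if x \in ~: finset.cover H then b else 0)%:E)%E _.
  rewrite sumEFin lee_fin -big_mkcondr /=.
  rewrite (eq_bigl (fun x => x \in ~: finset.cover H)); last first.
    by move=> x; rewrite sV finset.in_setT.
  rewrite sumr_const -[b *+ _]mulr_natr ler_wpM2l // ler_pdivrMr //.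
  by rewrite -natrM ler_nat mulnC.
apply: lee_sum => x xs; case: ifP => [|_]; last exact: sp_dist_ge0.
rewrite finset.in_setC => xN; apply: sp_dist_isolated => //.
  by rewrite eq_sym next_neq // sz.
move=> e eE xe; rewrite leNgt; apply: contra xN => /ltW web.
by apply/finset.bigcupP; exists e; rewrite // finset.in_set eE.
Qed.

Lemma TSP_finite : (TSP d < +oo)%E -> exists D tsp,
  [/\ pseudometric D, forall u v, d u v = (D u v)%:E, TSP d = tsp%:E, 0 < tsp
    & forall u v, D u v <= tsp].
Proof.
move=> tspfin.
have [_ [s sT <-] sfin] := ereal_inf_lt tspfin.
have [D mD dE] := finite_tour_sp_dist w_ge0 sT sfin.
have lb u v : ((D u v)%:E <= TSP d)%E.
  apply: le_ereal_inf_tmp => _ [q [uq qT] <-].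
  rewrite (tour_lengthE dE uq) lee_fin dist_le_cycle_length //.
  - by rewrite qT finset.in_setT.
  - by rewrite qT finset.in_setT.
have /card_gt1P[u [v [_ _ uv]]] := V2.
(* The default [1] makes [b] positive without first showing that [E] is nonempty. *)
pose b := \big[Order.min/1]_(e in E) w e.
have b0 : 0 < b by apply: lt_bigmin.
have bD : b <= D u v.
  rewrite -lee_fin -dE; apply: sp_dist_isolated => // e eE _.
  exact: bigmin_le_cond.
have tspN : (0%:E < TSP d)%E.
  by apply: lt_le_trans (lb u v); rewrite lte_fin (lt_le_trans b0).
have [tsp tspE] : exists tsp, TSP d = tsp%:E.
  by case: (TSP d) tspfin tspN => // r _ _; exists r.
exists D, tsp; split=> // [|x y]; first by rewrite -lte_fin -tspE.
by rewrite -lee_fin -tspE.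
Qed.

Lemma ratio_to_le D tsp c s : (forall u v, d u v = (D u v)%:E) ->
  TSP d = tsp%:E -> 0 < tsp -> uniq s -> cycle_length D s <= c * tsp ->
  (ratio_to (TSP d) (tour_length d s) <= c%:E)%E.
Proof.
move=> dE -> tsp0 us sc; rewrite /ratio_to /= (tour_lengthE dE us).
by rewrite inver gt_eqF // -EFinM lee_fin ler_pdivrMr.
Qed.

Lemma ratio_ge0 s : (0 <= ratio_to (TSP d) (tour_length d s))%E.
Proof.
have len0 q : (0 <= tour_length d q)%E by rewrite sume_ge0 // => x _; exact: sp_dist_ge0.
rewrite /ratio_to; case: ifP => // _; rewrite mule_ge0 // inve_ge0.
by apply: le_ereal_inf_tmp => _ [q _ <-].
Qed.

(** The crude bound for the exceptional event: each of the [#|V|] steps costs at most [tsp], and the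
    ratio is 1 when no tour is finite. *)
Lemma ratio_le_card s : tour_on [set: V]%SET s ->
  (ratio_to (TSP d) (tour_length d s) <= #|V|%:R%:E)%E.
Proof.
move=> sT; case: (ltP (TSP d) +oo)%E => [/TSP_finite|]; last first.
  by rewrite leye_eq /ratio_to => ->; rewrite lee_fin ler1n; case: #|V| V2.
move=> [D [tsp [mD dE tspE tsp0 Dle]]]; apply: (ratio_to_le dE tspE tsp0).
  by case: sT.
rewrite -(size_tour sT); case: s {sT} => [|x p] /=; first by rewrite mul0r.
have : forall q y, walk_length D y q <= (size q)%:R * tsp; last first.
  by move=> /(_ (rcons p x) x); rewrite size_rcons.
elim=> [|z q IH] y /=; first by rewrite mul0r.
by rewrite -natr1 mulrDl mul1r addrC lerD.
Qed.

(** For nearest neighbor the steps sum to at most [\sum_v f v] and the closing step costs at most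
    [tsp]; for insertion the initial tour costs at most [tsp] and the insertions
    [2 * \sum_v f v]. *)
Lemma heuristic_ratio_le D tsp s (c : R) : pseudometric D ->
  (forall u v, d u v = (D u v)%:E) -> TSP d = tsp%:E -> 0 < tsp ->
  (forall u v, D u v <= tsp) ->
  (forall f, separated D f -> \sum_v f v <= c * tsp) ->
  nn_tour d s \/ (exists rule, insertion_tour rule d s) ->
  (ratio_to (TSP d) (tour_length d s) <= (1 + 2 * c)%:E)%E.
Proof.
move=> mD dE tspE tsp0 Dle hc hs.
have ht : tour_on [set: V]%SET s by case: hs => [[]|[? []]].
have s0 : forall f, separated D f -> 0 <= \sum_v f v by move=> f [f0 _ _]; exact: sumr_ge0.
apply: (ratio_to_le dE tspE tsp0); first by case: ht.
case: hs => [[run _]|[rule [run _]]].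
  have [x [p [f [-> sf wf]]]] := nn_run_separated mD dE run.
  rewrite /= walk_length_rcons.
  have := Dle (last x p) x; have := hc _ sf; have := s0 _ sf; lra.
have hT S p : optimal_tour_on d S p -> cycle_length D p <= tsp.
  move=> op; rewrite -lee_fin -tspE; apply: le_ereal_inf_tmp => _ [q qT <-].
  rewrite (tour_lengthE dE); last by case: qT.
  by rewrite lee_fin (optimal_tour_le mD dE op qT).
have [f [sf hf]] := insertion_run_separated mD dE hT run.
have := hc _ sf; lra.
Qed.

End RatioBounds.

(** * Edge events in the random graph *)

Section OuterBound.
Context {R : realType} {disp : measure_display} {T : measurableType disp}.
Variable P : probability T R.
Implicit Types (E : set T) (x : R).

(** A bound on outer probability, so that union bounds apply to events without a proof of their
    measurability. *)
Definition outer_le E x : Prop :=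
  exists B, [/\ measurable B, E `<=` B & (P B <= x%:E)%E].

Lemma outer_le_sub E E' x y : E `<=` E' -> x <= y -> outer_le E' x -> outer_le E y.
Proof.
move=> sE xy [B [mB EB PB]]; exists B; split=> //; first exact: subset_trans EB.
by apply: le_trans PB _; rewrite lee_fin.
Qed.

Lemma outer_le0 x : 0 <= x -> outer_le set0 x.
Proof. by move=> x0; exists set0; split=> //; rewrite measure0 lee_fin. Qed.

Lemma outer_leU E E' x y : outer_le E x -> outer_le E' y -> outer_le (E `|` E') (x + y).
Proof.
move=> [B [mB EB PB]] [B' [mB' EB' PB']]; exists (B `|` B'); split.
- exact: measurableU.
- exact: setUSS.
- by apply: le_trans (measureU2 P mB mB') _; rewrite EFinD leeD.
Qed.

Lemma outer_le_sum (I : finType) (Q : pred I) (E : I -> set T) (x : I -> R) :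
  (forall i, Q i -> outer_le (E i) (x i)) ->
  outer_le [set t | exists2 i, Q i & E i t] (\sum_(i | Q i) x i).
Proof.
move=> hE; apply: (@outer_le_sub _ (\big[setU/set0]_(i | Q i) E i) _ _ _ (lexx _)).
  by move=> t [i Qi Et]; rewrite (bigD1 i) //; left.
elim/big_ind2: _ => //; first exact: outer_le0.
by move=> E1 x1 E2 x2; exact: outer_leU.
Qed.

End OuterBound.

Definition threshold_graph {R : realType} {V : finType} (E : {set {set V}})
  (w : {set V} -> R) (b : R) : {set {set V}} := [set e in E | (w e <= b)%R]%SET.

Lemma card_vpair n : #|{: vpair n}| = 'C(n, 2).
Proof.
rewrite card_sig -[n in RHS]card_ord -card_draws cardsE.
by apply: eq_card => e; rewrite !inE.
Qed.

(** * Independence and union bounds for threshold graphs *)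

Section RandomGraph.
Context {R : realType} {disp : measure_display} {T : measurableType disp}.
Variables (P : probability T R) (n : nat) (p : R).
Variables (G : T -> {set {set 'I_n}}) (w : {set 'I_n} -> {RV P >-> R}).
Hypothesis hER : erdos_renyi_exp p G w.
Hypothesis p01 : 0 <= p <= 1.
Local Notation H t b := (threshold_graph (G t) (fun e => w e t) b).
Local Notation q b := (p * (1 - expR (- b))).

Lemma weight_le (e : vpair n) (b : R) : 0 <= b ->
  distribution P (w (val e)) `]-oo, b] = (1 - expR (- b))%:E.
Proof.
move=> b0.
have -> : `]-oo, b]%classic = `]-oo, 0[ `|` `[0, b] :> set R.
  apply/seteqP; split=> x /=; rewrite !in_itv /=.
    by case: (ltP x 0) => x0 xb; [left|right; rewrite xb].
  by case=> [x0|/andP[]//]; rewrite (le_trans (ltW x0)).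
rewrite measureU //=; last first.
  apply/seteqP; split=> x //= [] /=; rewrite !in_itv /= => x0 /andP[].
  by rewrite leNgt x0.
rewrite !(er_weight hER) // [X in (X + _)%E]integral0_eq ?add0e; last first.
  by move=> x; rewrite /= in_itv /= => x0; rewrite lt0_exponential_pdf.
move: b0; rewrite le_eqVlt => /orP[/eqP<-|b0].
  by rewrite set_itv1 /exponential_prob integral_set1 oppr0 expR0 subrr.
by rewrite exponential_prob_itv0c // mulN1r.
Qed.

Lemma weight_gt (e : vpair n) (b : R) : 0 <= b ->
  distribution P (w (val e)) `]b, +oo[ = (expR (- b))%:E.
Proof.
move=> b0; rewrite -setCitvl probability_setC //. rewrite [X in (1 - X)%E](weight_le e b0).
by rewrite -EFinB; congr EFin; lra.
Qed.

(** The event takes one generator for each presence index in [F1] and each weight index in [F2], so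
    independence turns its probability into a product. *)
Lemma prob_cylinder (F1 F2 : {set vpair n}) (s : vpair n -> bool) (B : set R) (beta : R) :
  measurable B -> (forall e : vpair n, distribution P (w (val e)) B = beta%:E) ->
  let C := [set t | (forall e, e \in F1 -> (val e \in G t) = s e) /\
                    (forall e, e \in F2 -> B (w (val e) t))] in
  measurable C /\
  P C = ((\prod_(e in F1) (if s e then p else 1 - p)) * beta ^+ #|F2|)%:E.
Proof.
move=> mB hB C.
pose J : {set vpair n + vpair n} :=
  [set k | match k with inl e => e \in F1 | inr e => e \in F2 end]%SET.
pose A (k : vpair n + vpair n) : set T := match k with
  | inl e => [set t | (val e \in G t) = s e]
  | inr e => w (val e) @^-1` B end.
have CE : C = \bigcap_(k in [set` J]) A k.
  apply/seteqP; split=> t /=.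
    by case=> h1 h2 [e|e] /=; rewrite finset.in_set => eF; [exact: h1|exact: h2].
  move=> h; split=> e eF.
    by apply: (h (inl e)); rewrite /= finset.in_set.
  by apply: (h (inr e)); rewrite /= finset.in_set.
have mA k : measurable (A k).
  case: k => e /=; last exact: measurable_sfunP.
  have mG := er_measurable hER e; case: (s e) => //.
  rewrite (_ : [set t | _] = ~` [set t | val e \in G t]); first exact: measurableC.
  by apply/seteqP; split=> t /=; case: (_ \in _).
have PA k : P (A k) = (match k with inl e => (if s e then p else 1 - p) | inr e => beta end)%:E.
  case: k => e /=; last exact: hB.
  have mG := er_measurable hER e; have PG := er_prob hER e.
  case: (s e) => //.
  rewrite (_ : [set t | _] = ~` [set t | val e \in G t]).
    by rewrite probability_setC // PG.
  by apply/seteqP; split=> t /=; case: (_ \in _).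
split.
  by rewrite CE; apply: fin_bigcap_measurable.
rewrite CE (er_independent hER); last first.
  move=> [e|e] _ /=.
    exists [set s e] => //; by rewrite setTI.
  by exists B => //; rewrite setTI.
rewrite (eq_bigr _ (fun k _ => PA k)) prodEFin; congr EFin.
rewrite big_sumType /=; congr (_ * _).
  by apply: eq_bigl => e; rewrite finset.in_set.
rewrite -[RHS]prodr_const; apply: eq_bigl => e.
by rewrite finset.in_set.
Qed.

Lemma outer_all_edges (F : {set vpair n}) b : 0 <= b ->
  outer_le P [set t | forall e, e \in F -> val e \in H t b] (q b ^+ #|F|).
Proof.
move=> b0; have [mC PC] := prob_cylinder F F (fun=> true) (measurable_itv _) (fun e => weight_le e b0).
eexists; split; [exact: mC| |].
- by move=> t /= h; split=> e eF; have := h e eF; rewrite finset.in_set => /andP[].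
- by rewrite PC prodr_const -exprMn.
Qed.

(** The event splits by the set [J] of pairs of [F] present in the graph, all of which must be
    heavy. Summing the products over [J] recovers [(1 - q b) ^+ #|F|]. *)
Lemma outer_no_edge (F : {set vpair n}) b : 0 <= b ->
  outer_le P [set t | forall e, e \in F -> val e \notin H t b]
    (expR (- (q b * #|F|%:R))).
Proof.
move=> b0; have /andP[p0 p1] := p01.
(* On [F], [x] is the probability of being present but heavy and [y] that of being absent; off [F]
   the values add up to a neutral factor 1. *)
pose x e := if e \in F then p * expR (- b) else 0.
pose y e := if e \in F then 1 - p else 1.
have x0 e : 0 <= x e by rewrite /x; case: ifP => // _; rewrite mulr_ge0 // expR_ge0.
have y0 e : 0 <= y e by rewrite /y; case: ifP => // _; rewrite subr_ge0.
have tot : \sum_(J : {set vpair n}) \prod_e (if e \in J then x e else y e)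
           <= expR (- (q b * #|F|%:R)).
  rewrite -(bigA_distr _ _ x y) (bigID [in F]) /= [X in _ * X]big1 ?mulr1; last first.
    by move=> e /negbTE eF; rewrite /x /y eF add0r.
  rewrite (eq_bigr (fun=> 1 - q b)); last first.
    by move=> e eF; rewrite /x /y eF; ring.
  rewrite prodr_const -[- (_ * #|F|%:R)]mulNr expRM_natr.
  apply: lerXn2r; rewrite ?nnegrE ?expR_ge0 //.
    rewrite subr_ge0 mulr_ile1 // ?gerBl ?expR_ge0 //.
    by rewrite subr_ge0 -expR0 ler_expR oppr_le0.
  by apply: le_trans (expR_ge1Dx _); rewrite addrC.
apply: (outer_le_sub _ _ (@outer_le_sum _ _ _ P {set vpair n} (fun J => J \subset F)
  (fun J => [set t | (forall e, e \in F -> (val e \in G t) = (e \in J)) /\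
                     (forall e, e \in J -> `]b, +oo[%classic (w (val e) t))])
  (fun J => \prod_e (if e \in J then x e else y e)) _)).
- move=> t /= h; exists [set e in F | val e \in G t]%SET.
    by apply/fintype.subsetP => e; rewrite finset.in_set => /andP[].
  split=> e; first by rewrite finset.in_set => ->.
  rewrite finset.in_set => /andP[eF eG]; have := h e eF.
  by rewrite finset.in_set eG /= -ltNge in_itv andbT.
- apply: le_trans tot; rewrite [leRHS](bigID (fun J : {set vpair n} => J \subset F)) /=.
  rewrite lerDl sumr_ge0 // => J _; apply: prodr_ge0 => e _; by case: ifP.
- move=> J JF.
  have [mC PC] := prob_cylinder F J (fun e => e \in J) (measurable_itv `]b, +oo[) (fun e => weight_gt e b0).
  eexists; split; [exact: mC|by []|].
  rewrite PC lee_fin le_eqVlt; apply/orP; left; apply/eqP.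
  rewrite -prodr_const (big_mkcond [in F]) (big_mkcond [in J]) -big_split /=.
  apply: eq_bigr => e _; rewrite /x /y; have := fintype.subsetP JF e.
  by case: (e \in J); case: (e \in F) => //= h; rewrite ?mulr1 //; have := h isT.
Qed.

(** A union bound over sets [A] of size [a] and [C] of size [c] containing [A], with none of the
    [a * (n - c)] pairs between [A] and the complement of [C] being an edge. *)
Lemma outer_not_expands a c b : 0 <= b -> (c <= n)%N ->
  outer_le P [set t | ~ expands (H t b) a c]
    ('C(n, a)%:R * 'C(n, c)%:R * expR (- (q b * (a * (n - c))%:R))).
Proof.
move=> b0 cn; have /andP[p0 p1] := p01.
have q0 : 0 <= q b.
  by rewrite mulr_ge0 // subr_ge0 -expR0 ler_expR oppr_le0.
pose F (A C : {set 'I_n}) : {set vpair n} :=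
  [set e : vpair n | [exists x in A, [exists y in ~: C, val e == [set x; y]]]]%SET.
pose ac (X : {set 'I_n} * {set 'I_n}) := (#|X.1| == a) && (#|X.2| == c).
(* As [A] lies inside [C], it is disjoint from the complement of [C], so distinct ordered pairs give
   distinct two-element sets. *)
have cardF (A C : {set 'I_n}) : A \subset C -> #|A| = a -> #|C| = c -> (a * (n - c) <= #|F A C|)%N.
  move=> AC cA cC.
  have cC' : #|~: C| = (n - c)%N by rewrite finset.cardsCs finset.setCK card_ord cC.
  rewrite -cA -cC' -finset.cardsX.
  rewrite -(card_imset (F A C) val_inj).
  rewrite -(card_in_imset (f := fun u : 'I_n * 'I_n => [set u.1; u.2]%SET)); last first.
    move=> [x y] [x' y'] /=; rewrite !finset.in_setX /= !finset.in_setC.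
    move=> /andP[xA yC] /andP[x'A y'C] /setP eqs.
    have ne u v : u \in A -> v \notin C -> (u == v) = false.
      move=> uA; apply: contraNF => /eqP <-; exact: (fintype.subsetP AC).
    have := eqs x; have := eqs y; rewrite !finset.in_set2 !eqxx orbT /=.
    rewrite (ne x y') // orbF (eq_sym y x') (ne x' y) //=.
    by move=> /esym/eqP-> /esym/eqP->.
  apply/subset_leq_card/fintype.subsetP => e /imsetP[[x y]].
  rewrite finset.in_setX /= => /andP[xA yC] ->.
  have xy : #|[set x; y]%SET| == 2%N.
    rewrite finset.cards2; suff -> : x != y by [].
    apply: contraTneq xA => ->; apply: contra_notN (negP (_ : y \notin C)).
      by move/(fintype.subsetP AC).
    by rewrite -finset.in_setC.
  apply/imsetP; exists (exist _ [set x; y]%SET xy) => //.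
  rewrite finset.in_set; apply/exists_inP; exists x => //.
  by apply/exists_inP; exists y.
apply: (outer_le_sub _ _ (@outer_le_sum _ _ _ P _ ac
  (fun X => [set t | X.1 \subset X.2 /\ forall e, e \in F X.1 X.2 -> val e \notin H t b])
  (fun=> expR (- (q b * (a * (n - c))%:R))) _)).
- move=> t /= /existsNP[A /not_implyP[aA /negP]]; rewrite -leqNgt => nA.
  (* A failing [A] is shrunk to exactly [a] vertices, which only shrinks its neighbourhood, and that
     neighbourhood is then enlarged to exactly [c] vertices. *)
  have /card_geqP[l [ul ls lA]] := aA.
  pose A0 : {set 'I_n} := [set x in l]%SET.
  have cA0 : #|A0| = a by rewrite cardsE (card_uniqP ul).
  have A0A : A0 \subset A by apply/fintype.subsetP => x; rewrite finset.in_set => /lA.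
  have nA0 : (#|nbh (H t b) A0| <= c)%N.
    apply: leq_trans nA; apply: subset_leq_card; apply/fintype.subsetP => y.
    rewrite !finset.in_setU !finset.in_set => /orP[yl|/exists_inP[x xA xy]].
      by rewrite lA.
    apply/orP; right; apply/exists_inP; exists x => //.
    exact: (fintype.subsetP A0A).
  have [C NC cC] : exists2 C : {set 'I_n}, nbh (H t b) A0 \subset C & #|C| = c.
    set N := nbh _ _ in nA0 *.
    have : (c - #|N| <= #|~: N|)%N.
      by rewrite [leqRHS]finset.cardsCs finset.setCK card_ord leq_sub2r.
    case/card_geqP=> l' [ul' ls' lN].
    exists (N :|: [set x in l'])%SET; first exact: finset.subsetUl.
    rewrite finset.cardsU (_ : N :&: [set x in l'] = finset.set0)%SET.
      by rewrite finset.cards0 subn0 [X in (_ + X)%N]cardsE (card_uniqP ul') ls' subnKC.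
    apply/setP => x; rewrite finset.in_setI finset.in_set finset.in_set0.
    by apply/negP => /andP[xN /lN]; rewrite finset.in_setC xN.
  exists (A0, C); first by rewrite /ac /= cA0 cC !eqxx.
  split=> /= [|e]; first exact: fintype.subset_trans (nbh_sub _ _) NC.
  rewrite finset.in_set => /exists_inP[x xA /exists_inP[y yC /eqP eE]].
  apply: contraTN yC => eH; rewrite finset.in_setC negbK.
  apply: (fintype.subsetP NC); rewrite finset.in_setU [X in _ || X]finset.in_set.
  by apply/orP; right; apply/exists_inP; exists x => //; rewrite -eE.
- rewrite sumr_const -[leLHS]mulr_natl ler_wpM2r ?expR_ge0 // -natrM ler_nat.
  rewrite -[n in 'C(n, a)]card_ord -[n in 'C(n, c)]card_ord -!card_draws -finset.cardsX.
  apply/subset_leq_card/fintype.subsetP => -[A C] /=.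
  by rewrite finset.in_setX !finset.in_set.
- move=> [A C] /andP[/= /eqP cA /eqP cC].
  have [AC|AC] := boolP (A \subset C); last first.
    apply: (outer_le_sub _ _ (outer_le0 P (lexx 0))); last exact: expR_ge0.
    by move=> t /= [].
  apply: (outer_le_sub _ _ (outer_no_edge (F A C) b0)); first by move=> t /= [].
  by rewrite ler_expR lerN2 ler_wpM2l // ler_nat cardF.
Qed.

Lemma outer_many_edges m b : 0 <= b ->
  outer_le P [set t | (m <= #|H t b|)%N] ('C('C(n, 2), m)%:R * q b ^+ m).
Proof.
move=> b0.
apply: (outer_le_sub _ _ (@outer_le_sum _ _ _ P {set vpair n} (fun F => #|F| == m)
  (fun F => [set t | forall e, e \in F -> val e \in H t b]) (fun=> q b ^+ m) _)).
- move=> t /=; set K := [set e : vpair n | val e \in H t b]%SET => h.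
  have KE : val @: K = H t b.
    apply/setP => e; apply/imsetP/idP => [[f fK ->]|eH]; first by move: fK; rewrite finset.in_set.
    have e2 : #|e| == 2%N.
      by apply/eqP; apply: (er_simple hER (t := t)); move: eH; rewrite finset.in_set => /andP[].
    by exists (exist _ e e2) => //; rewrite finset.in_set.
  have : (m <= #|K|)%N by rewrite -(card_imset K val_inj) KE.
  case/card_geqP=> l [ul ls lK]; exists [set x in l]%SET.
    by rewrite cardsE (card_uniqP ul) ls.
  by move=> e; rewrite finset.in_set => /lK; rewrite finset.in_set.
- rewrite sumr_const -[leLHS]mulr_natl -card_vpair -card_draws cardsE.
  by [].
- move=> F /eqP <-; exact: outer_all_edges.
Qed.

(** Exponential weights are positive only almost surely; this null event collects the exceptions. *)
Lemma outer_nonpos_weight : outer_le P [set t | exists e : vpair n, w (val e) t <= 0] 0.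
Proof.
apply: (outer_le_sub _ _ (@outer_le_sum _ _ _ P _ (fun=> true)
  (fun e : vpair n => [set t | w (val e) t <= 0]) (fun=> 0) _)).
- by move=> t /= [e he]; exists e.
- by rewrite big1.
- move=> e _; exists (w (val e) @^-1` `]-oo, 0]); split.
  + exact: measurable_sfunP.
  + by move=> t; rewrite /= in_itv.
  + by have := weight_le e (lexx 0); rewrite oppr0 expR0 subrr => <-.
Qed.

End RandomGraph.

(** * Failure probabilities *)

Section BinomialBounds.
Context {R : realType}.
Implicit Types (n a k : nat) (x : R).

(** The product of the binomial with [x ^+ a] is one term of the expansion of [(1 + x) ^+ n], which
    is at most [expR (n x)]. *)
Lemma bin_le_expR n a x : 0 < x -> 'C(n, a)%:R <= expR (n%:R * x) * x ^- a.
Proof.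
move=> x0; have [an|na] := leqP a n; last first.
  by rewrite bin_small // mulr_ge0 ?expR_ge0 ?invr_ge0 ?exprn_ge0 // ltW.
rewrite ler_pdivlMr ?exprn_gt0 //.
apply: le_trans (_ : (1 + x) ^+ n <= _).
  have an' : (a < n.+1)%N by [].
  rewrite exprDn (bigD1 (Ordinal an')) //= expr1n mul1r.
  rewrite mulr_natl lerDl sumr_ge0 // => i _.
  by rewrite mulrn_wge0 // mulr_ge0 ?exprn_ge0 // ltW.
rewrite mulrC expRM_natr; apply: lerXn2r; rewrite ?nnegrE ?expR_ge0 ?expR_ge1Dx //.
by rewrite addr_ge0 // ltW.
Qed.

Lemma bin_le_natpow n a : 'C(n, a)%:R <= n%:R ^+ a :> R.
Proof.
rewrite -natrX ler_nat; apply: leq_trans (_ : n ^_ a <= _)%N.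
  by rewrite -bin_ffact leq_pmulr // fact_gt0.
elim: a => [|a IH]; first by rewrite ffactn0 expn0.
by rewrite ffactnSr expnSr leq_mul // leq_subr.
Qed.

(** Takes [x = 2 ^ -k] in [bin_le_expR]; the remaining power of two is at most [expR (k a)] with
    [a <= 2 n / 2 ^ k]. *)
Lemma bin_scale_le n k : (2 ^ k <= n)%N ->
  'C(n, (n %/ 2 ^ k).+1)%:R <= expR (n%:R / 2 ^+ k * (1 + 2 * k%:R)) :> R.
Proof.
move=> kn; have d0 : 0 < 2 ^+ k :> R by rewrite exprn_gt0.
apply: le_trans (bin_le_expR _ _ (_ : 0 < (2 ^+ k)^-1)) _; first by rewrite invr_gt0.
rewrite -[X in _ * X]exprVn invrK mulrDr mulr1 expRD ler_wpM2l ?expR_ge0 //.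
set a := (n %/ 2 ^ k).+1.
have aR : a%:R <= 2 * (n%:R / 2 ^+ k) :> R.
  rewrite mulrA ler_pdivlMr // -(natrX _ 2) -!natrM ler_nat /a mulSn mul2n -addnn.
  by rewrite leq_add // leq_divM.
apply: le_trans (_ : expR (k%:R * a%:R) <= _); last first.
  have := ler_wpM2l (ler0n R k) aR; rewrite ler_expR.
  by move: (n%:R / 2 ^+ k) => Y; lra.
rewrite expRM_natr; apply: lerXn2r; rewrite ?nnegrE ?expR_ge0 ?exprn_ge0 //.
rewrite -[k%:R]mul1r expRM_natr; apply: lerXn2r; rewrite ?nnegrE ?expR_ge0 //.
exact: expR_ge1Dx.
Qed.

Lemma expRN_le_inv x : 0 <= x -> expR (- x) <= (1 + x)^-1.
Proof.
by move=> x0; rewrite expRN lef_pV2 ?posrE ?expR_gt0 ?expR_ge1Dx // ltr_wpDr.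
Qed.

Lemma one_sub_expRN_ge0 x : 0 <= x -> 0 <= 1 - expR (- x).
Proof. by move=> x0; rewrite subr_ge0 -expR0 ler_expR oppr_le0. Qed.

Lemma one_sub_expRN_ge x : 0 <= x <= 1 -> x / 2 <= 1 - expR (- x).
Proof.
case/andP=> x0 x1; have := expRN_le_inv x0.
have : (1 + x)^-1 <= 1 - x / 2.
  rewrite -[leLHS]mul1r ler_pdivrMr; last by lra.
  by nra.
lra.
Qed.

End BinomialBounds.

(** * Numerical estimates of the union-bound terms *)

Section FailureBounds.
Context {R : realType}.
Variables (n : nat) (p : R).
Hypothesis (p0 : 0 < p) (n4 : (4 <= n)%N).
Local Notation q b := (p * (1 - expR (- b))).

Let n0 : 0 < n%:R :> R. Proof. by rewrite ltr0n (leq_trans _ n4). Qed.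

(** Here [y] stands for [2 ^ k]. The binomials contribute at most [21 + 15 = 36] times [z * y ^+ 4],
    against at least [384 / 8 = 48] from the missing edges. *)
Lemma scale_exponent (v k : nat) (a z y : R) : 3 * 2 ^+ 7 <= a -> (v < 3)%N -> 0 <= z ->
  1 <= y -> k%:R <= y ->
  z * (1 + 2 * (3 * v.+1 * k).+1%:R) + z * y ^+ 3 * (1 + 2 * (3 * v * k).+1%:R)
    - a / 8 * y ^+ 4 * z <= - (12 * (z * y ^+ 4)).
Proof.
move=> ha v3 z0 y1 ky.
have h1 : 1 + 2 * (3 * v.+1 * k).+1%:R <= 21 * y.
  have : (3 * v.+1 * k).+1%:R <= 9 * k%:R + 1 :> R.
    rewrite -natr1 lerD2r -natrM ler_nat leq_mul2r; apply/orP; right.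
    by clear -v3; lia.
  by lra.
have h2 : 1 + 2 * (3 * v * k).+1%:R <= 15 * y.
  have : (3 * v * k).+1%:R <= 6 * k%:R + 1 :> R.
    rewrite -natr1 lerD2r -natrM ler_nat leq_mul2r; apply/orP; right.
    by clear -v3; lia.
  by lra.
have y3 : 1 <= y ^+ 3 by rewrite exprn_ege1.
have y0 : 0 <= y by lra.
have t1 : z * (1 + 2 * (3 * v.+1 * k).+1%:R) <= 21 * (z * y ^+ 4).
  apply: le_trans (ler_wpM2l z0 h1) _; rewrite mulrCA ler_wpM2l // ler_wpM2l //.
  by rewrite exprSr -[leLHS]mul1r ler_wpM2r.
have t2 : z * y ^+ 3 * (1 + 2 * (3 * v * k).+1%:R) <= 15 * (z * y ^+ 4).
  have zy : 0 <= z * y ^+ 3 by rewrite mulr_ge0 // exprn_ge0.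
  by apply: le_trans (ler_wpM2l zy h2) _; rewrite [y ^+ 4]exprSr; lra.
have t3 : 48 * (z * y ^+ 4) <= a / 8 * y ^+ 4 * z.
  rewrite -mulrA [y ^+ 4 * z]mulrC ler_wpM2r ?mulr_ge0 ?exprn_ge0 //.
  by lra.
lra.
Qed.

(** With [Y = n / (2 y ^ 5)], the exponential of [12 Y] is at least [(2 Y) ^ 6 = n ^ 6 / y ^ 30],
    and [y ^ 30 <= y ^ 36 <= n ^ 4]. *)
Lemma expR_cube_decay (z y : R) : 1 <= y -> 2 * y ^+ 9 <= n%:R ->
  n%:R / (2 * y ^+ 9) <= z -> expR (- (12 * (z * y ^+ 4))) <= n%:R ^- 2.
Proof.
move=> y1 yn zn; have y0 : 0 < y by lra.
have y5 k : 0 < y ^+ k by rewrite exprn_gt0.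
pose Y := n%:R / (2 * y ^+ 5).
have Y0 : 0 <= Y by rewrite divr_ge0 ?mulr_ge0 // ltW.
have YZ : Y <= z * y ^+ 4.
  apply: le_trans (ler_wpM2r (ltW (y5 4)) zn).
  rewrite /Y le_eqVlt; apply/orP; left; apply/eqP; field.
  by rewrite gt_eqF.
apply: le_trans (_ : expR (- (12 * Y)) <= _).
  by rewrite ler_expR lerN2 ler_wpM2l.
rewrite expRN lef_pV2 ?posrE ?expR_gt0 ?exprn_gt0 //.
have -> : 12 * Y = 2 * Y * 6%:R by ring.
rewrite expRM_natr; apply: le_trans (_ : (2 * Y) ^+ 6 <= _); last first.
  apply: lerXn2r; rewrite ?nnegrE ?expR_ge0 //; first exact: mulr_ge0.
  by apply: le_trans (expR_ge1Dx _); lra.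
have -> : (2 * Y) ^+ 6 = n%:R ^+ 6 / y ^+ 30.
  by rewrite /Y; field; rewrite gt_eqF.
rewrite ler_pdivlMr //.
have n4' : y ^+ 36 <= n%:R ^+ 4.
  have -> : y ^+ 36 = (y ^+ 9) ^+ 4 by rewrite -exprM.
  apply: lerXn2r; rewrite ?nnegrE; [exact: ltW|exact: ltW|].
  by apply: le_trans yn; have := y5 9; lra.
have -> : n%:R ^+ 6 = n%:R ^+ 2 * n%:R ^+ 4 :> R by rewrite -exprD.
apply: ler_wpM2l; first exact/exprn_ge0/ltW.
by apply: le_trans n4'; apply: ler_weXn2l.
Qed.

(** The threshold is at most 1, so [1 - expR (- x) >= x / 2] gives [q n >= a y ^ 4 / 2] with
    [y = 2 ^ k]. At least [n / 4] vertices lie outside the target set, hence the exponent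
    [a y ^ 4 z / 8]. *)
Lemma scale_failure_le (v k : nat) (a : R) (h := a / (n%:R * p)) :
  3 * 2 ^+ 7 <= a -> (v < 3)%N -> (2 ^ (9 * k).+1 <= n)%N ->
  a * 16 ^+ k <= n%:R * p ->
  'C(n, scale_size n v.+1 k)%:R * 'C(n, scale_size n v k)%:R *
  expR (- (q (h * 16 ^+ k) * (scale_size n v.+1 k * (n - scale_size n v k))%:R))
  <= n%:R ^- 2.
Proof.
move=> ha v3 kn kp; have [a0 np0] : 0 < a /\ 0 < n%:R * p.
  split; last exact: mulr_gt0.
  by apply: lt_le_trans ha; rewrite mulr_gt0.
pose y : R := 2 ^+ k.
have y1 : 1 <= y by rewrite exprn_ege1 // ler1n.
have y0 : 0 < y by lra.
have ky : k%:R <= y by rewrite /y -natrX ler_nat ltnW // ltn_expl.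
have dE u : 2 ^+ (3 * u * k).+1 = 2 * y ^+ (3 * u) :> R.
  by rewrite exprS /y -exprM [(k * _)%N]mulnC.
pose z := n%:R / 2 ^+ (3 * v.+1 * k).+1 : R.
have z0 : 0 < z by rewrite divr_gt0 // exprn_gt0.
have zE : n%:R / 2 ^+ (3 * v * k).+1 = z * y ^+ 3.
  rewrite /z !dE mulnS exprD; field.
  by rewrite !gt_eqF ?exprn_gt0.
have dn u : (u <= 3)%N -> (2 ^ (3 * u * k).+1 <= n)%N.
  move=> u3; apply: leq_trans kn; rewrite leq_exp2l // ltnS leq_mul2r.
  by apply/orP; right; clear -u3; lia.
have b1 := @bin_scale_le R n _ (dn v.+1 v3).
have b2 := @bin_scale_le R n _ (dn v (ltnW v3)).
have sz1 : z <= (scale_size n v.+1 k)%:R.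
  rewrite /z ler_pdivrMr ?exprn_gt0 // -natrX -natrM ler_nat /scale_size.
  by rewrite ltnW // ltn_ceil // expn_gt0.
have sz2 : n%:R / 4 <= (n - scale_size n v k)%:R :> R.
  rewrite ler_pdivrMr // -natrM ler_nat /scale_size.
  have : (n %/ 2 ^ (3 * v * k).+1 <= n %/ 2)%N.
    by rewrite leq_div2l // -[leqLHS]expn1 leq_exp2l.
  by move: (n %/ 2 ^ (3 * v * k).+1)%N => c; clear -n4; lia.
have tau0 : 0 <= h * 16 ^+ k by rewrite mulr_ge0 ?divr_ge0 ?exprn_ge0 // ltW.
have tau1 : h * 16 ^+ k <= 1 by rewrite /h mulrAC ler_pdivrMr // mul1r.
have hq : a / 2 * y ^+ 4 <= q (h * 16 ^+ k) * n%:R.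
  have /one_sub_expRN_ge hh : 0 <= h * 16 ^+ k <= 1 by rewrite tau0.
  have y4 : 16 ^+ k = y ^+ 4 by rewrite /y -exprM mulnC exprM; congr (_ ^+ _); ring.
  apply: le_trans (_ : p * (h * 16 ^+ k / 2) * n%:R <= _).
    rewrite /h y4 le_eqVlt; apply/orP; left; apply/eqP; field.
    by rewrite !gt_eqF.
  by rewrite ler_wpM2r ?ler_wpM2l // ltW.
have q0 : 0 <= q (h * 16 ^+ k).
  by rewrite mulr_ge0 ?(ltW p0) // one_sub_expRN_ge0.
apply: le_trans (@expR_cube_decay z y y1 _ _).
- apply: le_trans (_ : expR (n%:R / 2 ^+ (3 * v.+1 * k).+1 * (1 + 2 * (3 * v.+1 * k).+1%:R))
    * expR (n%:R / 2 ^+ (3 * v * k).+1 * (1 + 2 * (3 * v * k).+1%:R))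
    * expR (- (a / 8 * y ^+ 4 * z)) <= _).
    rewrite ler_pM ?mulr_ge0 ?expR_ge0 //; first by rewrite ler_pM.
    rewrite ler_expR lerN2 natrM.
    apply: le_trans (_ : q (h * 16 ^+ k) * (z * (n%:R / 4)) <= _).
      have -> : q (h * 16 ^+ k) * (z * (n%:R / 4)) = q (h * 16 ^+ k) * n%:R * (z / 4) by ring.
      apply: le_trans (ler_wpM2r (_ : 0 <= z / 4) hq); last by rewrite divr_ge0 // ltW.
      lra.
    rewrite ler_wpM2l // ler_pM ?divr_ge0 // ltW //.
  by rewrite -!expRD ler_expR -/z zE; apply: scale_exponent => //; exact: ltW.
- by rewrite /y -exprM mulnC -exprS -natrX ler_nat.
- rewrite /z dE ler_wpM2l ?(ltW p0) // lef_pV2 ?posrE ?mulr_gt0 ?exprn_gt0 //.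
  rewrite ler_wpM2l //; apply: ler_weXn2l => //.
  by clear -v3; lia.
Qed.

(** Threshold 8 gives [q 8 >= 8 p / 9], and at least [n / 2] vertices lie outside, so
    [9 ln n <= n p] makes the exponential at most [n ^ (-4 s)]. The binomials cost only
    [n ^ (3 s - 1)]. *)
Lemma doubling_failure_le (s : nat) : 9 * ln n%:R <= n%:R * p -> (0 < s <= n %/ 4)%N ->
  'C(n, s)%:R * 'C(n, s.*2.-1)%:R * expR (- (q 8 * (s * (n - s.*2.-1))%:R))
  <= n%:R ^- 2.
Proof.
move=> hp /andP[s0 sn].
have q8 : 8 / 9 * p <= q 8.
  rewrite mulrC ler_wpM2l ?(ltW p0) //.
  have := @expRN_le_inv R 8 (ler0n _ _).
  by rewrite (_ : 1 + 8 = 9) => [|]; lra.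
have hs : s%:R * (n%:R / 2) <= (s * (n - s.*2.-1))%:R :> R.
  rewrite natrM ler_wpM2l // ler_pdivrMr // -natrM ler_nat.
  by have := leq_divM n 4; lia.
have he : 4 * s%:R * ln n%:R <= q 8 * (s * (n - s.*2.-1))%:R.
  apply: le_trans (_ : 8 / 9 * p * (s%:R * (n%:R / 2)) <= _).
    have := ler_wpM2l (ler0n R s) hp; lra.
  by rewrite ler_pM // ?mulr_ge0 ?invr_ge0 // ?(ltW p0) // ltW.
have en : expR (- (q 8 * (s * (n - s.*2.-1))%:R)) <= n%:R ^- (4 * s).
  apply: le_trans (_ : expR (- (4 * s%:R * ln n%:R)) <= _).
    by rewrite ler_expR lerN2.
  rewrite expRN; have -> : 4 * s%:R * ln n%:R = ln n%:R * (4 * s)%:R :> R by rewrite natrM; ring.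
  by rewrite expRM_natr lnK ?posrE.
apply: le_trans (_ : n%:R ^+ s * n%:R ^+ s.*2.-1 * n%:R ^- (4 * s) <= _).
  by rewrite ler_pM ?mulr_ge0 ?expR_ge0 // ler_pM ?bin_le_natpow.
rewrite -exprD ler_pdivrMr ?exprn_gt0 // mulrC ler_pdivlMr ?exprn_gt0 // -exprD.
by apply: ler_weXn2l; [rewrite ler1n -(ltr0n R)|lia].
Qed.

(** With [x = 1 / n] in [bin_le_expR] the product is at most [expR (n - 8 m)], where
    [m = (n %/ 4).+1] satisfies [4 m >= n]. *)
Lemma edges_failure_le : 
  'C('C(n, 2), (n %/ 4).+1)%:R * q (expR (- 8) / (n%:R * p)) ^+ (n %/ 4).+1 <= n%:R^-1.
Proof.
set m := (n %/ 4).+1; set b := expR (- 8) / (n%:R * p).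
have b0 : 0 <= b by rewrite divr_ge0 ?expR_ge0 // mulr_ge0 ?(ltW p0) ?(ltW n0).
have q0 : 0 <= q b by apply: mulr_ge0; [exact: ltW|exact: one_sub_expRN_ge0].
have qb : q b <= expR (- 8) / n%:R.
  have -> : expR (- 8) / n%:R = p * b by rewrite /b; field; rewrite !gt_eqF.
  by apply: ler_wpM2l; [exact: ltW|have := expR_ge1Dx (- b); lra].
apply: le_trans (_ : expR ('C(n, 2)%:R * n%:R^-1) * n%:R^-1 ^- m * (expR (- 8) / n%:R) ^+ m <= _).
  rewrite ler_pM ?exprn_ge0 //; first by apply: bin_le_expR; rewrite invr_gt0.
  by rewrite lerXn2r ?nnegrE // divr_ge0 ?expR_ge0 // ltW.
rewrite -[X in _ * X * _]exprVn invrK -mulrA -exprMn [n%:R * _]mulrC divfK ?gt_eqF //.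
rewrite -expRM_natr -expRD.
apply: le_trans (_ : expR (- n%:R) <= _); last first.
  rewrite expRN lef_pV2 ?posrE ?expR_gt0 //.
  by apply: le_trans (expR_ge1Dx _); lra.
have h1 : 'C(n, 2)%:R * n%:R^-1 <= n%:R :> R.
  by rewrite ler_pdivrMr // -expr2 bin_le_natpow.
have h2 : n%:R <= 4 * m%:R :> R.
  by rewrite -natrM ler_nat /m mulnC ltnW // ltn_ceil.
by rewrite ler_expR; lra.
Qed.

End FailureBounds.

(** * Integrals of possibly nonmeasurable functions *)

Section IntegralBound.
Context {R : realType} {disp : measure_display} {T : measurableType disp}.
Variable P : probability T R.
Local Open Scope ereal_scope.

Let measurable_indic_scale (k : \bar R) (B : set T) : measurable B ->
  measurable_fun setT ((fun t => k * (\1_B t)%:E) : T -> \bar R).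
Proof.
move=> mB; apply: emeasurable_funM; first exact: measurable_cst.
by apply/measurable_EFinP; exact: measurable_indic.
Qed.

Let indic_scale_ge0 (k : \bar R) (B : set T) t : 0 <= k -> 0 <= k * (\1_B t)%:E.
Proof. by move=> k0; rewrite mule_ge0 // lee_fin. Qed.

Let integral_indic_scale (k : \bar R) (B : set T) : measurable B -> 0 <= k ->
  \int[P]_t (k * (\1_B t)%:E) = k * P B.
Proof.
move=> mB k0; rewrite ge0_integralZl //.
- by rewrite integral_indic // setIT.
- by apply/measurable_EFinP; exact: measurable_indic.
Qed.

(* The integral of a nonnegative function is the supremum over the simple
   functions below it, so it is monotone also on nonmeasurable functions. *)
Let le_integral (f1 f2 : T -> \bar R) : (forall t, 0 <= f1 t) ->
  (forall t, f1 t <= f2 t) -> \int[P]_t f1 t <= \int[P]_t f2 t.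
Proof.
move=> f10 f12; rewrite !ge0_integralTE //.
  by apply: ereal_sup_le => _ [h hf <-]; exists h => // t; exact: le_trans (hf t) (f12 t).
by move=> t; apply: le_trans (f12 t).
Qed.

(** The positive part is dominated by [c] plus [m] on the cover of [B] plus [+oo] on the null cover
    of [N]; the negative part lives on that null cover only. *)
Lemma abse_integral_le (f : T -> \bar R) (N B : set T) (c m x : R) :
  outer_le P N 0 -> outer_le P B x -> (0 <= c)%R -> (0 <= m)%R ->
  (forall t, ~ N t -> 0 <= f t <= m%:E) ->
  (forall t, ~ N t -> ~ B t -> f t <= c%:E) ->
  `|\int[P]_t f t| <= (c + m * x)%:E.
Proof.
move=> [N' [mN NN' PN']] [B' [mB BB' PB']] c0 m0 fm fc.
have PN0 : P N' = 0 by apply/eqP; rewrite eq_le PN' measure_ge0.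
have indic1 (A : set T) t : A t -> (\1_A t)%:E = 1 :> \bar R.
  by move=> At; rewrite indicE mem_set.
have hneg : \int[P]_t f^\- t = 0.
  apply/eqP; rewrite eq_le integral_ge0 ?andbT; last by move=> t _; exact: funeneg_ge0.
  apply: le_trans (_ : _ <= \int[P]_t (+oo * (\1_N' t)%:E)) _; last first.
    by rewrite integral_indic_scale // PN0 mule0.
  apply: le_integral => t; first exact: funeneg_ge0.
  have [Nt|Nt] := pselect (N' t).
    by rewrite (indic1 _ _ Nt) mule1 leey.
  have /andP[f0 _] := fm t (fun h => Nt (NN' _ h)).
  rewrite funenegE (_ : maxe _ _ = 0); first exact: indic_scale_ge0.
  by apply/max_idPr; rewrite leeNl oppe0.
have hpos : \int[P]_t f^\+ t <= (c + m * x)%:E.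
  apply: le_trans (_ : _ <= \int[P]_t (c%:E + m%:E * (\1_B' t)%:E + +oo * (\1_N' t)%:E)) _; last first.
    have gB t : setT t -> 0 <= m%:E * (\1_B' t)%:E by move=> _; rewrite indic_scale_ge0 ?lee_fin.
    have gN t : setT t -> 0 <= (+oo : \bar R) * (\1_N' t)%:E by move=> _; rewrite indic_scale_ge0.
    have gc (t : T) : setT t -> 0 <= cst c%:E t :> \bar R by rewrite lee_fin.
    have gcB t : setT t -> 0 <= c%:E + m%:E * (\1_B' t)%:E.
      by move=> tT; rewrite adde_ge0 ?gB ?lee_fin.
    have mB' := measurable_indic_scale m%:E mB.
    have mcB : measurable_fun setT (fun t => c%:E + m%:E * (\1_B' t)%:E).
      by apply: emeasurable_funD mB'; exact: measurable_cst.
    rewrite (ge0_integralD P measurableT gcB mcB gN (measurable_indic_scale (+oo : \bar R) mN)).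
    rewrite (ge0_integralD P measurableT gc (measurable_cst _) gB mB').
    rewrite !integral_indic_scale ?lee_fin // PN0 mule0 adde0.
    have -> : \int[P]_t cst c%:E t = c%:E.
      by rewrite (integral_cst P measurableT) [X in _ * X](@probability_setT _ _ _ P) mule1.
    rewrite EFinD EFinM leeD2l //.
    by rewrite lee_wpmul2l ?lee_fin.
  apply: le_integral => t; first exact: funepos_ge0.
  have [Nt|Nt] := pselect (N' t).
    rewrite (indic1 _ _ Nt) mule1.
    have : 0 <= c%:E + m%:E * (\1_B' t)%:E by rewrite adde_ge0 ?indic_scale_ge0 ?lee_fin.
    by case: (c%:E + _) => [r||] // _; rewrite ?addey ?leey.
  have Nt' : ~ N t by move=> h; exact: Nt (NN' _ h).
  have /andP[f0 ftm] := fm t Nt'.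
  rewrite funeposE (_ : maxe _ _ = f t); last by apply/max_idPl.
  apply: (@le_trans _ _ (c%:E + m%:E * (\1_B' t)%:E)); last first.
    by rewrite leeDl // indic_scale_ge0.
  have [Bt|Bt] := pselect (B' t).
    by rewrite (indic1 _ _ Bt) mule1 (le_trans ftm) // leeDr ?lee_fin.
  apply: le_trans (fc t Nt' (fun h => Bt (BB' _ h))) _.
  by rewrite leeDl // indic_scale_ge0 ?lee_fin.
rewrite integralE hneg sube0 gee0_abs //; apply: integral_ge0 => t _.
exact: funepos_ge0.
Qed.

End IntegralBound.

(** * Bounded ratio with high probability *)

(* The value 384 makes radius_const / 8 exceed by 12 the coefficient 21 + 15 of the
   binomial factors in scale_exponent. *)
Definition radius_const {R : realType} : R := 3 * 2 ^+ 7.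

(** This is [1 + 2 * c] from [heuristic_ratio_le], with the constants of [sum_separated_le] and
    [1 / p] replaced by [2 * expR 8 * tsp]. *)
Definition good_ratio {R : realType} : R :=
  1 + 2 * ((288 * radius_const + 12 * (16 * radius_const) ^+ 2) * (2 * expR 8) + 2048).

Lemma radius_const_gt0 {R : realType} : 0 < radius_const :> R.
Proof. by rewrite mulr_gt0 // exprn_gt0. Qed.

Lemma separated_const_ge0 {R : realType} :
  0 <= 288 * radius_const + 12 * (16 * radius_const) ^+ 2 :> R.
Proof.
have a0 := ltW (@radius_const_gt0 R).
apply: addr_ge0; apply: mulr_ge0; [exact: ler0n|exact: a0|exact: ler0n|].
by apply: exprn_ge0; apply: mulr_ge0; [exact: ler0n|].
Qed.

Lemma good_ratio_ge1 {R : realType} : 1 <= good_ratio :> R.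
Proof.
rewrite /good_ratio lerDl; apply: mulr_ge0; first exact: ler0n.
apply: addr_ge0; last exact: ler0n.
apply: mulr_ge0; first exact: separated_const_ge0.
by apply: mulr_ge0; [exact: ler0n|exact: expR_ge0].
Qed.

Section FixedSize.
Context {R : realType} {disp : measure_display} {T : measurableType disp}.
Variables (P : probability T R) (n : nat) (p : R).
Variables (G : T -> {set {set 'I_n}}) (w : {set 'I_n} -> {RV P >-> R}).
Hypothesis hER : erdos_renyi_exp p G w.
Hypothesis (p0 : 0 < p) (p1 : p <= 1).
Hypothesis (n16 : (16 <= n)%N) (n1024 : (2 ^ 10 <= n)%N).
Hypothesis (ln1 : 1 <= ln n%:R :> R) (npln : 9 * ln n%:R <= n%:R * p).
Local Notation a := (radius_const : R).
Hypothesis npa : a * 16 <= n%:R * p.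
Local Notation h := (a / (n%:R * p)).
Local Notation H t b := (threshold_graph (G t) (fun e => w e t) b).
Local Notation theta := (expR (- 8) / (n%:R * p)).
Local Notation d t := (sp_dist (G t) (fun e => w e t)).

Let n0 : 0 < n%:R :> R. Proof. by rewrite ltr0n; case: n n16. Qed.
Let np0 : 0 < n%:R * p. Proof. by rewrite mulr_gt0. Qed.
Let a0 : 0 < a. Proof. exact: radius_const_gt0. Qed.
Let h0 : 0 < h. Proof. by rewrite divr_gt0. Qed.
Let theta0 : 0 < theta. Proof. by rewrite divr_gt0 // expR_gt0. Qed.
Let p01 : 0 <= p <= 1. Proof. by rewrite (ltW p0). Qed.

(** Scale 1 is admissible by [n1024] and [npa], and admissible scales are bounded by [n]; the
    successor of the largest one violates one of the two constraints. *)
Lemma exists_last_scale : exists K, [/\ (0 < K)%N, (K <= n)%N, (2 ^ (9 * K).+1 <= n)%N,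
  a * 16 ^+ K <= n%:R * p
  & (n < 2 ^ (9 * K.+1).+1)%N \/ n%:R * p < a * 16 ^+ K.+1].
Proof.
pose Q k := (2 ^ (9 * k).+1 <= n)%N && (a * 16 ^+ k <= n%:R * p).
have Q1 : exists k, Q k by exists 1%N; rewrite /Q muln1 n1024 expr1.
have Qn k : Q k -> (k <= n)%N.
  case/andP=> kn _; apply: leq_trans kn; apply: leq_trans (ltnW (ltn_expl k (isT : 1 < 2)%N)) _.
  by rewrite leq_exp2l // leqW // leq_pmull.
case: (ex_maxnP Q1 Qn) => K QK Kmax; have [KN Kp] := andP QK.
exists K; split=> //.
- by apply: Kmax; rewrite /Q muln1 n1024 expr1.
- exact: Qn.
- have : ~~ Q K.+1 by apply/negP => /Kmax; rewrite ltnn.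
  by rewrite negb_and -ltnNge -ltNge => /orP.
Qed.

(** The index [kv.1] stands for scale [kv.1.+1]. The last event is the one that would spoil the
    lower bound on the optimal tour. *)
Definition bad_event K : set T :=
  [set t | exists2 kv : 'I_K * 'I_3, true & ~ expands (H t (h * 16 ^+ kv.1.+1))
     (scale_size n kv.2.+1 kv.1.+1) (scale_size n kv.2 kv.1.+1)]
  `|` [set t | exists2 s : 'I_n, (0 < s <= n %/ 4)%N & ~ expands (H t 8) s s.*2.-1]
  `|` [set t | ((n %/ 4).+1 <= #|H t theta|)%N].

(** At most [3 n] scale events and [n] doubling events, each of outer probability at most [n ^- 2],
    and one event of at most [1 / n]. *)
Lemma outer_bad_event K : (K <= n)%N -> (2 ^ (9 * K).+1 <= n)%N ->
  a * 16 ^+ K <= n%:R * p -> outer_le P (bad_event K) (5 / n%:R).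
Proof.
move=> Kn KN Kp.
have n4 : (4 <= n)%N by exact: leq_trans n16.
have nn2 (m : nat) (x : R) : (m%:R <= x * n%:R) -> m%:R * n%:R ^- 2 <= x / n%:R.
  move=> mx; have -> : x / n%:R = x * n%:R * n%:R ^- 2 by field; rewrite gt_eqF.
  by rewrite ler_wpM2r // invr_ge0 exprn_ge0 // ltW.
have -> : 5 / n%:R = 3 / n%:R + 1 / n%:R + 1 / n%:R :> R by rewrite -!mulrDl; congr (_ / _); ring.
apply: outer_leU; first apply: outer_leU.
- apply: (outer_le_sub _ _ (outer_le_sum (x := fun=> n%:R ^- 2) _)); first by move=> t; apply.
    rewrite sumr_const -[leLHS]mulr_natl; apply: nn2.
    by rewrite cardT -cardE card_prod !card_ord -natrM ler_nat mulnC leq_mul2l Kn.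
  move=> [k v] _ /=.
  have kK : (k < K)%N by [].
  have tau0 : 0 <= h * 16 ^+ k.+1 by rewrite mulr_ge0 ?exprn_ge0 // ltW.
  have dn : (2 ^ (9 * k.+1).+1 <= n)%N.
    by apply: leq_trans KN; rewrite leq_exp2l // ltnS leq_mul2l.
  have cn : (scale_size n v k.+1 <= n)%N.
    rewrite /scale_size; apply: leq_ltn_trans (_ : n %/ 2 < _)%N; last by rewrite ltn_Pdiv // (leq_trans _ n4).
    by rewrite leq_div2l // -[leqLHS]expn1 leq_exp2l.
  apply: (outer_le_sub _ _ (outer_not_expands hER p01 (scale_size n v.+1 k.+1) tau0 cn)) => //.
  apply: (scale_failure_le p0 n4 (lexx a) (ltn_ord v) dn).
  apply: le_trans Kp; rewrite ler_wpM2l ?(ltW a0) //.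
  by apply: ler_weXn2l => //; rewrite ler1n.
- apply: (outer_le_sub _ _ (outer_le_sum (x := fun=> n%:R ^- 2) _)); first by move=> t; apply.
    rewrite sumr_const -[leLHS]mulr_natl; apply: nn2; rewrite mul1r ler_nat.
    by apply: leq_trans (max_card _) _; rewrite card_ord.
  move=> s /andP[s0 sn].
  have cn : (s.*2.-1 <= n)%N by have := leq_divM n 4; clear -sn s0; lia.
  apply: (outer_le_sub _ _ (outer_not_expands hER p01 s (ler0n R 8) cn)) => //.
  by apply: (doubling_failure_le p0 n4 npln); rewrite s0.
apply: (outer_le_sub _ _ (outer_many_edges hER (n %/ 4).+1 (ltW theta0))) => //.
by rewrite mul1r; exact: edges_failure_le.
Qed.

Lemma good_ratio_le K t s : (0 < K)%N -> (2 ^ (9 * K).+1 <= n)%N ->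
  a * 16 ^+ K <= n%:R * p ->
  (n < 2 ^ (9 * K.+1).+1)%N \/ n%:R * p < a * 16 ^+ K.+1 ->
  (forall e : vpair n, 0 < w (val e) t) -> ~ bad_event K t ->
  nn_tour (d t) s \/ (exists rule, insertion_tour rule (d t) s) ->
  (ratio_to (TSP (d t)) (tour_length (d t) s) <= good_ratio%:E)%E.
Proof.
move=> K0 KN Kp Kmax wpos /not_orP[/not_orP[nb1 nb2] nb3] hs.
have E2 e : e \in G t -> #|e| = 2%N by exact: (er_simple hER).
have w_gt0 e : e \in G t -> 0 < w e t.
  by move=> /E2/eqP e2; exact: (wpos (exist _ e e2)).
have w_ge0 e (eG : e \in G t) := ltW (w_gt0 e eG).
have n2 : (1 < #|'I_n|)%N by rewrite card_ord (leq_trans _ n16).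
case: (ltP (TSP (d t)) +oo)%E => [/(TSP_finite w_gt0 n2)|]; last first.
  by rewrite leye_eq /ratio_to => ->; rewrite lee_fin; exact: good_ratio_ge1.
move=> [D [tsp [mD dE tspE tsp0 Dle]]].
apply: (heuristic_ratio_le mD dE tspE tsp0 Dle) => // f sf.
have HD b x y : [set x; y]%SET \in H t b -> D x y <= b.
  rewrite finset.in_set => /andP[xy wb]; rewrite -lee_fin -dE.
  by apply: le_trans (sp_dist_edge w_ge0 xy) _; rewrite lee_fin.
have scales k v : (0 < k <= K)%N -> (v < 3)%N ->
    expands (H t (h * 16 ^+ k)) (scale_size n v.+1 k) (scale_size n v k).
  case: k => // k kK v3; apply: contrapT => ne; apply: nb1.
  by exists (Ordinal (kK : (k < K)%N), Ordinal v3).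
have doubling s' : (0 < s' <= n %/ 4)%N -> expands (H t 8) s' s'.*2.-1.
  move=> s'n; apply: contrapT => ne; apply: nb2.
  have s'lt : (s' < n)%N.
    case/andP: s'n => _ s'n; apply: leq_ltn_trans s'n _.
    by rewrite ltn_Pdiv // (leq_trans _ n16).
  by exists (Ordinal s'lt).
have := @sum_separated_le R 'I_n D (fun b => H t b) a p tsp K mD HD.
rewrite card_ord => /(_ scales doubling Dle a0 p0 n16 ln1 npln K0 KN Kp Kmax f sf).
move=> /le_trans; apply; rewrite [leRHS]mulrDl lerD2r -!mulrA.
apply: ler_wpM2l; first exact: separated_const_ge0.
have few : (4 * #|[set e in G t | (w e t <= theta)%R]%SET| <= #|'I_n|)%N.
  rewrite card_ord; move/negP: nb3; rewrite -ltnNge ltnS => few.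
  by apply: leq_trans (leq_mul (leqnn 4) few) _; rewrite mulnC leq_divM.
(* The left side is [expR (- 8) / (2 p)], which yields [1 / p <= 2 * expR 8 * tsp]. *)
have : ((theta * (n%:R / 2))%:E <= tsp%:E)%E.
  rewrite -tspE; apply: le_ereal_inf_tmp => _ [q qT <-].
  have := tour_length_isolated w_gt0 n2 (ltW theta0) E2 few qT.
  by rewrite card_ord.
rewrite lee_fin => htsp; have e0 : 0 <= 2 * expR 8 :> R by rewrite mulr_ge0 // expR_ge0.
rewrite mulrA; apply: le_trans (ler_wpM2l e0 htsp).
rewrite expRN le_eqVlt; apply/orP; left; apply/eqP; field.
by rewrite !gt_eqF // expR_gt0.
Qed.

Lemma expected_ratio_le (s : T -> seq 'I_n) :
  (forall t, nn_tour (d t) (s t) \/ exists rule, insertion_tour rule (d t) (s t)) ->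
  (`|\int[P]_t ratio_to (TSP (d t)) (tour_length (d t) (s t))|
   <= (good_ratio + 5)%:E)%E.
Proof.
move=> hs; have [K [K0 Kn KN Kp Kmax]] := exists_last_scale.
have n2 : (1 < #|'I_n|)%N by rewrite card_ord (leq_trans _ n16).
have sT t : tour_on [set: 'I_n]%SET (s t) by case: (hs t) => [[]|[? []]].
have w_gt0 t e : ~ (exists e : vpair n, w (val e) t <= 0) -> e \in G t -> 0 < w e t.
  move=> nN eG; have e2 : #|e| == 2%N by rewrite (er_simple hER eG).
  by rewrite ltNge; apply/negP => we; apply: nN; exists (exist _ e e2).
(* The crude ratio [n] on an event of outer probability at most [5 / n] costs 5 in expectation. *)
have -> : good_ratio + 5 = good_ratio + n%:R * (5 / n%:R) :> R.
  by congr (_ + _); field; rewrite gt_eqF.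
apply: (abse_integral_le (outer_nonpos_weight hER) (outer_bad_event Kn KN Kp)).
- by apply: le_trans good_ratio_ge1; exact: ler01.
- exact: ler0n.
- move=> t nN; have wp e := w_gt0 t e nN.
  rewrite ratio_ge0 //=.
  by have := ratio_le_card wp n2 (sT t); rewrite card_ord.
- move=> t nN nB; apply: (good_ratio_le K0 KN Kp Kmax) => // e.
  by rewrite ltNge; apply/negP => we; apply: nN; exists e.
Qed.

End FixedSize.

(** * Asymptotics: the size conditions hold for all large [n] *)

Theorem theorem9 (R : realType) (eps c : R)
  (heps0 : 0 < eps) (heps1 : eps < 1) (hc : 9 / eps ^+ 2 < c)
  (p : nat -> R) (hp01 : forall n, 0 <= p n <= 1)
  (hp : \forall n \near \oo, c * ln n%:R / n%:R <= p n)
  (disp : nat -> measure_display) (T : forall n, measurableType (disp n))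
  (P : forall n, probability (T n) R)
  (G : forall n, T n -> {set {set 'I_n}})
  (w : forall n, {set 'I_n} -> {RV (P n) >-> R})
  (hG : forall n, erdos_renyi_exp (p n) (@G n) (@w n))
  (dist : forall n, T n -> 'I_n -> 'I_n -> \bar R)
  (hdist : forall n t, @dist n t = sp_dist (G n t) (fun e => w n e t))
  (nn : forall n, T n -> seq 'I_n)
  (hnn : forall n t, (0 < n)%N -> nn_tour (@dist n t) (nn n t))
  (hnn_meas : forall n s, measurable [set t : T n | nn n t = s])
  (rule : forall n, insertion_rule R 'I_n)
  (ins : forall n, T n -> seq 'I_n)
  (hins : forall n t, (0 < n)%N ->
     insertion_tour (rule n) (@dist n t) (ins n t))
  (hins_meas : forall n s, measurable [set t : T n | ins n t = s]) :
  is_O1 (fun n => \int[P n]_t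
    ratio_to (TSP (@dist n t)) (tour_length (@dist n t) (nn n t)))%E
  /\
  is_O1 (fun n => \int[P n]_t
    ratio_to (TSP (@dist n t)) (tour_length (@dist n t) (ins n t)))%E.
Proof.
have c9 : 9 < c.
  apply: le_lt_trans hc; rewrite ler_pdivlMr ?exprn_gt0 //.
  by rewrite -[leRHS]mulr1 ler_wpM2l // exprn_ile1 // ltW.
suff main : \forall n \near \oo, forall s : T n -> seq 'I_n,
    (forall t, nn_tour (@dist n t) (s t) \/
               exists rule, insertion_tour rule (@dist n t) (s t)) ->
    (`|\int[P n]_t ratio_to (TSP (@dist n t)) (tour_length (@dist n t) (s t))|
     <= (good_ratio + 5)%:E)%E.
  split; exists (good_ratio + 5); near=> n; have npos : (0 < n)%N by near: n; exists 1%N.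
  - apply: (near main n) => // t; left; exact: hnn.
  - apply: (near main n) => // t; right; exists (rule n); exact: hins.
near=> n => s hs.
have pn : c * ln n%:R / n%:R <= p n by near: n.
have n1024 : (2 ^ 10 <= n)%N by near: n; exact: nbhs_infty_ge.
have nexp : expR (16 * radius_const) <= n%:R :> R by near: n; exact: nbhs_infty_ger.
have n16 : (16 <= n)%N by apply: leq_trans n1024.
have n0 : 0 < n%:R :> R by rewrite ltr0n; exact: leq_trans n16.
have lnn : 16 * radius_const <= ln n%:R :> R.
  by rewrite -[leLHS]expRK ler_ln ?posrE ?expR_gt0.
have a1 : 1 <= radius_const :> R.
  apply: le_trans (_ : 2 ^+ 7 <= _); first by rewrite exprn_ege1 // ler1n.
  by rewrite ler_peMl ?exprn_ge0 // ler1n.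
have ln1 : 1 <= ln n%:R :> R by lra.
have npc : c * ln n%:R <= n%:R * p n by rewrite [leRHS]mulrC -ler_pdivrMr.
have npln : 9 * ln n%:R <= n%:R * p n.
  by apply: le_trans npc; apply: ler_wpM2r; lra.
have p0 : 0 < p n by apply: lt_le_trans pn; apply: divr_gt0 => //; apply: mulr_gt0; lra.
have /andP[_ p1] := hp01 n.
have npa : radius_const * 16 <= n%:R * p n by lra.
under eq_integral do rewrite hdist.
apply: (expected_ratio_le (hG n)) => // t; rewrite -hdist; exact: hs.
Unshelve. all: by end_near. Qed.
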